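(* Let $N\ge1$, $\beta$ a non-negative integer and $\gamma$ a real parameter (such that the integrals below converge). For all $f,g\in\mathbb{C}[z_1^2,\dots,z_N^2]^{S_N}$, $$\langle G_{\mathrm L}f,g\rangle_L^{(\beta+1)}=\langle f,\hat G_{\mathrm L}g\rangle_L^{(\beta)}.$$
   Context: On functions of $z=(z_1,\dots,z_N)$: $s_{ij}$ swaps $z_i,z_j$; $t_j$ sends $z_j\mapsto -z_j$; $D^B_j=\partial_{z_j}+\beta\sum_{k\neq j}\left(\frac{1-s_{jk}}{z_j-z_k}+\frac{1-t_jt_ks_{jk}}{z_j+z_k}\right)+\gamma\frac{1-t_j}{z_j}$; $\tilde b^\dagger_j=\frac1{\sqrt2}(-D^B_j+2z_j)$, $\tilde b_j=\frac1{\sqrt2}D^B_j$; $\tilde h^B_j=\tilde b^\dagger_j\tilde b_j+\beta\sum_{k<j}(s_{jk}+t_jt_ks_{jk})$ (parameter $\beta$). $\mathcal X_{\mathrm L}=\prod_{i<j}(z_i^2-z_j^2)$, $\mathcal Y_{\mathrm L}=\prod_{i<j}(\beta-\tilde h^B_i/2+\tilde h^B_j/2)$, $\hat{\mathcal Y}_{\mathrm L}=\prod_{i<j}(-\beta-\tilde h^B_i/2+\tilde h^B_j/2)$, $G_{\mathrm L}=\mathcal X_{\mathrm L}^{-1}\mathcal Y_{\mathrm L}$, $\hat G_{\mathrm L}=\hat{\mathcal Y}_{\mathrm L}\mathcal X_{\mathrm L}$. The scalar product is $\langle f,g\rangle_L^{(\beta)}=\int_{\mathbb{R}^N}f(z)g(z)(\phi_B^{(\beta)})^2dz_1\cdots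 dz_N$ with $\phi_B^{(\beta)}=\prod_{j<k}|z_j^2-z_k^2|^\beta\prod_j|z_j|^\gamma e^{-z_j^2/2}$. $\mathbb{C}[z^2]^{S_N}$ denotes symmetric polynomials in $z_1^2,\dots,z_N^2$. *)

(* Defs.v *)
From HB Require Import structures.
From mathcomp Require Import all_boot all_order all_algebra all_fingroup.
From mathcomp Require Import complex.
From mathcomp Require Import mpoly.
From mathcomp Require Import all_classical all_reals all_analysis.

Set Implicit Arguments.
Unset Strict Implicit.
Unset Printing Implicit Defensive.

Import Order.TTheory GRing.Theory Num.Theory.
Local Open Scope ring_scope.
Local Open Scope complex_scope.
Local Open Scope classical_set_scope.

Section TypeBDunkl.
Context (R : realType) (N : nat) (beta : nat) (gamma : R).

Local Notation C := (R[i]).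
Local Notation P := (mpoly.mpoly N C).

Definition zvar (i : 'I_N) : P := mpoly.mpolyX C (mpoly.mnm1 i).

Definition sw (i j : 'I_N) (p : P) : P := mpoly.msym (tperm i j) p.

Definition tf (j : 'I_N) (p : P) : P :=
  mpoly.comp_mpoly [tuple (if i == j then - zvar i else zvar i) | i < N] p.

(* exact quotient p / d in the polynomial ring (chosen classically; the
   numerators used below are always divisible by the denominators) *)
Definition ediv (p d : P) : P := xget 0 [set q | p = d * q].

Definition DB (j : 'I_N) (p : P) : P :=
  mpoly.mderiv j p
  + (beta%:R : C) *: \sum_(k < N | k != j)
        (ediv (p - sw j k p) (zvar j - zvar k)
         + ediv (p - tf j (tf k (sw j k p))) (zvar j + zvar k))
  + (gamma%:C) *: ediv (p - tf j p) (zvar j).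

Definition isqrt2 : C := ((Num.sqrt (2 : R))^-1)%:C.

Definition bdag (j : 'I_N) (p : P) : P := isqrt2 *: (- DB j p + 2%:R *: (zvar j * p)).
Definition bop (j : 'I_N) (p : P) : P := isqrt2 *: DB j p.

Definition hB (j : 'I_N) (p : P) : P :=
  bdag j (bop j p)
  + (beta%:R : C) *: \sum_(k < N | (k < j)%N) (sw j k p + tf j (tf k (sw j k p))).

Definition pairs_lt : seq ('I_N * 'I_N) :=
  seq.filter (fun ij : 'I_N * 'I_N => (ij.1 < ij.2)%N) (enum {: 'I_N * 'I_N}).

Definition XL : P := \prod_(ij <- pairs_lt) (zvar ij.1 ^+ 2 - zvar ij.2 ^+ 2).

Definition Yfac (c : C) (ij : 'I_N * 'I_N) (p : P) : P :=
  c *: p - 2%:R^-1 *: hB ij.1 p + 2%:R^-1 *: hB ij.2 p.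

(* \mathcal Y_L and \hat{\mathcal Y}_L (composition of the commuting factors) *)
Definition YL (p : P) : P := foldr (fun ij q => Yfac (beta%:R) ij q) p pairs_lt.
Definition YLhat (p : P) : P := foldr (fun ij q => Yfac (- beta%:R) ij q) p pairs_lt.

(* points of R^N are represented by z : nat -> R (only z 0 .. z (N-1) matter) *)
Definition evalR (p : P) (z : nat -> R) : C := mpoly.meval (fun i : 'I_N => (z i)%:C) p.

Definition GL (f : P) : (nat -> R) -> C := fun z => evalR (YL f) z / evalR XL z.
Definition GLhat (g : P) : P := YLhat (XL * g).

Definition phiB (b : nat) (z : nat -> R) : R :=
  (\prod_(ij <- pairs_lt) `|z ij.1 ^+ 2 - z ij.2 ^+ 2| ^+ b)
  * \prod_(j < N) (`|z j| `^ gamma * expR (- (z j ^+ 2) / 2%:R)).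

Definition ncons (x : R) (z : nat -> R) : nat -> R :=
  fun k => if k is k'.+1 then z k' else x.

Fixpoint intRn (n : nat) (F : (nat -> R) -> R) : R :=
  if n is n'.+1 then
    Rintegral (@lebesgue_measure R) setT (fun x => intRn n' (fun z => F (ncons x z)))
  else F (fun _ => 0).

Definition intCN (F : (nat -> R) -> C) : C :=
  (intRn N (fun z => complex.Re (F z))) +i* (intRn N (fun z => complex.Im (F z))).

Definition scalL (b : nat) (F G : (nat -> R) -> C) : C :=
  intCN (fun z => F z * G z * ((phiB b z) ^+ 2)%:C).

Definition sym_in_squares (f : P) : Prop :=
  exists q : P, q \is mpoly.symmetric /\
    f = mpoly.comp_mpoly [tuple zvar i ^+ 2 | i < N] q.

End TypeBDunkl.

(* Main.v *)
(* On even polynomials f = F(z_1^2, ..., z_N^2) the operators D^B_j act through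
   type A Dunkl operators d_j in the variables u_j = z_j^2, and htilde_j / 2
   becomes
     H_j = u_j d_j + beta sum_(k < j) s_jk - (u_j d_j + beta sum_(k <> j) s_jk + gamma + 1/2) d_j.
   The H_j commute, satisfy the degenerate Hecke relations with the adjacent
   transpositions, and are self-adjoint for the pairing, which on even
   polynomials is the Laguerre moment functional weighted by the Vandermonde
   product to the power 2 beta; that functional is characterised by
   mu_(k+1) = (k + gamma + 1/2) mu_k.

   Pointwise, X_L^-1 Y_L f * g * phi^2 at beta + 1 is Y_L f * X_L g * phi^2 at
   beta, so everything reduces to <f, Y_L A> = <f, Yhat_L A> for f symmetric and
   A = X_L g antisymmetric. For such f and A the Hecke relations give
   <f, (w p)(H) A> = sgn(w) <f, p(H) A> for every polynomial p and permutation w,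
   and the longest permutation sends the polynomial of Y_L to that of Yhat_L up
   to exactly its own sign. *)

Require Import Defs.
From HB Require Import structures.
From mathcomp Require Import all_boot all_order all_algebra all_fingroup.
From mathcomp Require Import complex.
From mathcomp Require Import mpoly.
From mathcomp Require Import all_classical all_reals all_analysis.
From mathcomp Require Import measurable_realfun.
From mathcomp Require Import ring lra zify.

Import Order.TTheory GRing.Theory Num.Theory.
Local Open Scope ring_scope.

Set Implicit Arguments.
Unset Strict Implicit.
Unset Printing Implicit Defensive.

(** * Type A Dunkl operators *)

Section MpolyInduction.
Context (n : nat) (K : comNzRingType).
Implicit Types p q : {mpoly K[n]}.

(** Most operator relations below follow this scheme: linearity reduces them to the value at [1] and
    to compatibility with multiplication by one variable. *)
Lemma mpoly_indXM (P : {mpoly K[n]} -> Prop) :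
  P 1 -> (forall p q, P p -> P q -> P (p + q)) ->
  (forall c p, P p -> P (c *: p)) -> (forall i p, P p -> P ('X_i * p)) ->
  forall p, P p.
Proof.
move=> P1 PD PZ PX p; rewrite [p]mpolyE.
apply: (big_ind P) => [|q r|m _]; [by rewrite -(scale0r 1); apply: PZ|exact: PD|].
apply: (PZ); rewrite mpolyXE_id -[X in P X]mulr1.
pose Q (r : {mpoly K[n]}) := forall q, P q -> P (r * q).
suff /(_ 1 P1) : Q (\prod_(i < n) 'X_i ^+ m i) by [].
apply: (big_ind Q) => [q Pq|r1 r2 Q1 Q2 q Pq|i _ q Pq]; first by rewrite mul1r.
  by rewrite -mulrA; apply/Q1/Q2.
by elim: (m i) => [|k IH]; rewrite ?mul1r // exprS -mulrA; apply: PX.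
Qed.

Lemma msymXU (s : 'S_n) i : msym s 'X_i = 'X_(s i) :> {mpoly K[n]}.
Proof.
rewrite msymX; congr 'X_[_]; apply/mnmP => j; rewrite !mnmE.
by rewrite -(inj_eq (@perm_inj _ s)) permKV.
Qed.

Lemma msymC (s : 'S_n) c : msym s c%:MP = c%:MP :> {mpoly K[n]}.
Proof. by rewrite -[c%:MP]mulr1 mul_mpolyC msymZ msym1. Qed.
End MpolyInduction.

(* Guarded at [i = j], where any polynomial would be a quotient of [0 / 0].
   The operators are sealed, lest unification unfold them. *)
HB.lock Definition divdiff n (K : idomainType) (i j : 'I_n) (p : {mpoly K[n]})
    : {mpoly K[n]} :=
  if i == j then 0
  else xget 0 [set q | p - msym (tperm i j) p = ('X_i - 'X_j) * q]%classic.

HB.lock Definition dunkl n (K : idomainType) (b : K) (i : 'I_n) (p : {mpoly K[n]})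
    : {mpoly K[n]} :=
  p^`M(i) + b *: \sum_(k < n | k != i) divdiff i k p.

Section Dunkl.
Context (n : nat) (K : idomainType) (b : K).
Local Notation P := {mpoly K[n]}.
Local Notation s i j := (@msym n K (tperm i j)).
Local Notation divdiff := (@divdiff n K).
Implicit Types (p q : P) (i j k : 'I_n) (t : 'S_n).

Lemma s_X i j k : s i j 'X_k = 'X_(tperm i j k).
Proof. exact: msymXU. Qed.

Lemma s_K i j p : s i j (s i j p) = p.
Proof. by rewrite -msymMm tperm2 msym1m. Qed.

Lemma s_C i j : s i j =1 s j i.
Proof. by move=> p; rewrite tpermC. Qed.

Lemma msym_s t i j p : msym t (s i j p) = s (t i) (t j) (msym t p).
Proof. by rewrite -!msymMm -tpermJ conjgE mulgA mulgV mul1g. Qed.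

Lemma subX_neq0 i j : i != j -> 'X_i - 'X_j != 0 :> P.
Proof.
move=> ij; rewrite subr_eq0; apply: contraNneq ij.
move/(congr1 (mcoeff U_(i))); rewrite !mcoeffX eqxx.
case: eqVneq => [/mnmP/(_ i)|_ /eqP]; last by rewrite oner_eq0.
by rewrite !mnm1E eqxx eq_sym; case: eqVneq.
Qed.

Lemma divdiff_exists i j p : exists q, p - s i j p = ('X_i - 'X_j) * q.
Proof.
elim/mpoly_indXM: p => [|p1 p2 [q1 E1] [q2 E2]|c p [q E]|k p [q E]].
- by exists 0; rewrite msym1 subrr mulr0.
- by exists (q1 + q2); rewrite msymD mulrDr -E1 -E2; ring.
- by exists (c *: q); rewrite msymZ -scalerBr E scalerAr.
(* This is the twisted Leibniz rule: ['X_k * p] minus its swap is ['X_k * (p - s i j p)] plus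
   ['X_k - s i j 'X_k] times [s i j p], and the last difference is zero or plus or minus
   ['X_i - 'X_j]. *)
exists ('X_k * q + ((k == i)%:R - (k == j)%:R) * s i j p).
rewrite msymM s_X mulrDr mulrCA -E.
by case: tpermP => [->|->|/eqP/negPf -> /eqP/negPf ->]; rewrite ?eqxx;
  [case: eqVneq => [->|_]|rewrite eq_sym; case: eqVneq => [->|_]|] => /=; ring.
Qed.

Lemma divdiffP i j p : p - s i j p = ('X_i - 'X_j) * divdiff i j p.
Proof.
rewrite divdiff.unlock; case: eqVneq => [->|_]; first by rewrite tperm1 msym1m !subrr mul0r.
by apply: (@xgetPex _ 0 [set q | _ = _ * q]%classic); exact: divdiff_exists.
Qed.

Lemma divdiff_uniq i j p q :
  i != j -> p - s i j p = ('X_i - 'X_j) * q -> divdiff i j p = q.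
Proof.
by move=> ij; rewrite divdiffP => /(mulfI (subX_neq0 ij)).
Qed.

Lemma divdiff_is_linear i j : linear (divdiff i j).
Proof.
move=> c p q; have [->|ij] := eqVneq i j.
  by rewrite divdiff.unlock eqxx scaler0 addr0.
apply: divdiff_uniq => //; rewrite msymD msymZ mulrDr -scalerAr -!divdiffP.
by rewrite scalerBr opprD addrACA.
Qed.

HB.instance Definition _ i j :=
  GRing.isLinear.Build K P P _ (divdiff i j) (@divdiff_is_linear i j).

Lemma divdiffZ i j c p : divdiff i j (c *: p) = c *: divdiff i j p.
Proof. exact: linearZ. Qed.

Lemma divdiffXM i j k p : i != j ->
  divdiff i j ('X_k * p) =
  'X_k * divdiff i j p + ((k == i)%:R - (k == j)%:R) * s i j p.
Proof.
move=> ij; apply: divdiff_uniq => //.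
rewrite msymM s_X mulrDr mulrCA -divdiffP.
by case: tpermP => [->|->|/eqP/negPf -> /eqP/negPf ->]; rewrite ?eqxx;
  [rewrite (negPf ij)|rewrite eq_sym (negPf ij)|] => /=; ring.
Qed.

Lemma divdiff_sym0 i j p : i != j -> s i j p = p -> divdiff i j p = 0.
Proof. by move=> ij E; apply: divdiff_uniq => //; rewrite E subrr mulr0. Qed.

Lemma msym_divdiff t i j p :
  msym t (divdiff i j p) = divdiff (t i) (t j) (msym t p).
Proof.
have [->|ij] := eqVneq i j; first by rewrite divdiff.unlock !eqxx msym0.
apply/esym/divdiff_uniq; first by rewrite (inj_eq (@perm_inj _ t)).
by rewrite -msym_s -msymB divdiffP msymM msymB !msymXU.
Qed.

Lemma mderivXU i j : ('X_j)^`M(i) = (i == j)%:R :> P.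
Proof.
rewrite mderivX mnm1E eq_sym; case: eqVneq => [->|_]; last by rewrite scale0r.
rewrite scale1r (_ : U_(j) - U_(j) = 0)%MM ?mpolyX0 //.
by apply/mnmP => k; rewrite !mnmE subnn.
Qed.

Lemma msym_mderiv t i p : msym t p^`M(i) = (msym t p)^`M(t i).
Proof.
elim/mpoly_indXM: p => [|p q Ep Eq|c p E|j p E].
- by rewrite msym1 -mpolyC1 !mderivC msym0.
- by rewrite mderivD !msymD Ep Eq mderivD.
- by rewrite mderivZ !msymZ E mderivZ.
rewrite mderivM msymD !msymM msymXU E mderivM !mderivXU.
by rewrite (inj_eq (@perm_inj _ t)) rmorph_nat.
Qed.

Local Notation dunkl := (dunkl b).

Lemma dunkl_is_linear i : linear (dunkl i).
Proof.
move=> c p q; rewrite dunkl.unlock linearP /= [in LHS](eq_bigr _ (fun k _ => linearP _ c p q)).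
rewrite big_split /= -scaler_sumr !scalerDr !scalerA [b * c]mulrC.
by rewrite addrACA.
Qed.

HB.instance Definition _ i :=
  GRing.isLinear.Build K P P _ (dunkl i) (@dunkl_is_linear i).

Lemma dunklD i : {morph dunkl i : p q / p + q}. Proof. exact: raddfD. Qed.
Lemma dunklB i : {morph dunkl i : p q / p - q}. Proof. exact: raddfB. Qed.
Lemma dunklZ i c p : dunkl i (c *: p) = c *: dunkl i p. Proof. exact: linearZ. Qed.
Lemma dunkl0 i : dunkl i 0 = 0. Proof. exact: raddf0. Qed.

Definition sumswap i p : P := \sum_(k < n | k != i) s i k p.

(** Only the divided difference between [i] and [j] sees ['X_j], so the Leibniz rule leaves a single
    swap. *)
Lemma dunklXM_neq i j p : i != j ->
  dunkl i ('X_j * p) = 'X_j * dunkl i p - b *: s i j p.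
Proof.
move=> ij; rewrite dunkl.unlock mderivM mderivXU (negPf ij) mul0r add0r mulrDr -addrA.
congr (_ + _); rewrite -scalerAr -scalerBr; congr (_ *: _).
rewrite mulr_sumr (bigD1 j) 1?eq_sym //= [in RHS](bigD1 j) 1?eq_sym //=.
have ji : (j == i) = false by rewrite eq_sym (negPf ij).
rewrite divdiffXM // eqxx ji sub0r mulN1r addrAC; congr (_ + _ + _).
apply: eq_bigr => k /andP[ki kj].
have [ik jk] : i != k /\ j != k by rewrite eq_sym ki eq_sym.
by rewrite divdiffXM // ji (negPf jk) subrr mul0r addr0.
Qed.

Lemma dunklXM_eq i p :
  dunkl i ('X_i * p) = 'X_i * dunkl i p + p + b *: sumswap i p.
Proof.
rewrite dunkl.unlock mderivM mderivXU eqxx mul1r mulrDr -scalerAr.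
rewrite (mulr_sumr _ (fun k => k != i)).
transitivity ('X_i * p^`M(i) + p + b *: (\sum_(k < n | k != i) 'X_i * divdiff i k p
  + sumswap i p)); last by rewrite -!mul_mpolyC; ring.
rewrite [p + _]addrC; congr (_ + _ *: _); rewrite -big_split /=; apply: eq_bigr => k ki.
have ik : i != k by rewrite eq_sym.
by rewrite divdiffXM // eqxx (negPf ik) subr0 mul1r.
Qed.

Lemma msym_dunkl t i p : msym t (dunkl i p) = dunkl (t i) (msym t p).
Proof.
rewrite dunkl.unlock msymD msymZ msym_mderiv; congr (_ + _ *: _).
rewrite [LHS](raddf_sum (msym t)) /=.
rewrite [in RHS](reindex_inj (@perm_inj _ t)) /=.
apply: eq_big => [k|k _]; first by rewrite (inj_eq (@perm_inj _ t)).
exact: msym_divdiff.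
Qed.

Lemma dunkl_s1 i j p : s i j (dunkl i p) = dunkl j (s i j p).
Proof. by rewrite msym_dunkl tpermL. Qed.

Lemma dunkl_s2 i j p : s i j (dunkl j p) = dunkl i (s i j p).
Proof. by rewrite msym_dunkl tpermR. Qed.

(* The commutator of two Dunkl operators kills [1] and commutes with
   multiplication by each variable. *)
Lemma dunklC i j p : dunkl i (dunkl j p) = dunkl j (dunkl i p).
Proof.
have [->//|ij] := eqVneq i j.
have ji : j != i by rewrite eq_sym.
have d1 k : dunkl k 1 = 0.
  rewrite dunkl.unlock -mpolyC1 mderivC add0r big1 ?scaler0 // => l lk.
  by apply: divdiff_sym0; rewrite 1?eq_sym // mpolyC1 msym1.
elim/mpoly_indXM: p => [|p q Ep Eq|c p E|k p E].
- by rewrite !d1 !dunkl0.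
- by rewrite !dunklD Ep Eq.
- by rewrite !dunklZ E.
(* When the variable carries one of the two indices, the swap of [l] and [m] inside [sumswap]
   cancels the swap from [dunklXM_neq] on each side; every other swap in the sum fixes [m] and
   passes through [dunkl m]. *)
have key (l m : 'I_n) : l != m -> dunkl l (dunkl m p) = dunkl m (dunkl l p) ->
    dunkl l (dunkl m ('X_l * p)) = dunkl m (dunkl l ('X_l * p)).
  move=> lm E'; have ml : m != l by rewrite eq_sym.
  rewrite (dunklXM_neq _ ml) dunklXM_eq !(dunklB, dunklD, dunklZ).
  rewrite (dunklXM_neq _ ml) dunklXM_eq E' /sumswap [X in _ = _ + _ *: X](raddf_sum (dunkl m)) /=.
  rewrite (bigD1 m) 1?eq_sym //= [in RHS](bigD1 m) 1?eq_sym //=.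
  rewrite -[dunkl m (s l m p)]dunkl_s1.
  rewrite !(s_C m l) -dunkl_s2 [X in _ + b *: (_ + X) - _](eq_bigr (fun k => dunkl m (s l k p))).
    by rewrite -!mul_mpolyC; ring.
  by move=> h /andP[hl hm]; rewrite msym_dunkl tpermD // eq_sym.
have [->|ki] := eqVneq k i; first exact: key.
have [->|kj] := eqVneq k j; first by apply/esym/key.
have [ik jk] : i != k /\ j != k by rewrite eq_sym ki eq_sym kj.
have e1 : tperm j k i = i by rewrite tpermD.
have e2 : tperm i k j = j by rewrite tpermD.
rewrite (dunklXM_neq _ jk) (dunklXM_neq _ ik) !(dunklB, dunklZ).
rewrite (dunklXM_neq _ ik) (dunklXM_neq _ jk) E !msym_dunkl e1 e2 -!mul_mpolyC.
ring.
Qed.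

End Dunkl.

(** * The commuting Hamiltonians *)

HB.lock Definition euler n (K : idomainType) (b : K) (i : 'I_n) (p : {mpoly K[n]})
    : {mpoly K[n]} :=
  'X_i * dunkl b i p.

(** For [c = gamma - 1/2] this is a quarter of the squared type B Dunkl operator, read on even
    polynomials. With a Dunkl operator outermost, its relations can be proved under that
    operator. *)
HB.lock Definition lower n (K : idomainType) (b c : K) (i : 'I_n) (p : {mpoly K[n]})
    : {mpoly K[n]} :=
  dunkl b i (euler b i p + c *: p).

(* Jucys-Murphy elements. *)
HB.lock Definition jm n (K : idomainType) (i : 'I_n) (p : {mpoly K[n]})
    : {mpoly K[n]} :=
  \sum_(k < n | (k < i)%N) msym (tperm i k) p.

HB.lock Definition ham n (K : idomainType) (b c : K) (i : 'I_n) (p : {mpoly K[n]})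
    : {mpoly K[n]} :=
  euler b i p + b *: jm i p - lower b c i p.

Section Hamiltonian.
Context (n : nat) (K : idomainType) (b c : K).
Local Notation P := {mpoly K[n]}.
Local Notation s i j := (@msym n K (tperm i j)).
Local Notation d := (dunkl b).
Implicit Types (p q : P) (i j k : 'I_n) (t : 'S_n).

Local Notation jm := (@jm n K).
Local Notation euler := (euler b).
Local Notation lower := (lower b c).
Local Notation ham := (ham b c).

Lemma euler_is_linear i : linear (euler i).
Proof. by move=> a p q; rewrite euler.unlock dunklD dunklZ mulrDr scalerAr. Qed.

HB.instance Definition _ i :=
  GRing.isLinear.Build K P P _ (euler i) (@euler_is_linear i).

Lemma eulerD i : {morph euler i : p q / p + q}. Proof. exact: raddfD. Qed.
Lemma eulerB i : {morph euler i : p q / p - q}. Proof. exact: raddfB. Qed.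
Lemma eulerZ i a p : euler i (a *: p) = a *: euler i p. Proof. exact: linearZ. Qed.

Lemma lower_is_linear i : linear (lower i).
Proof.
move=> a p q; rewrite lower.unlock eulerD eulerZ -dunklZ -dunklD; congr (d i _).
by rewrite -!mul_mpolyC; ring.
Qed.

HB.instance Definition _ i :=
  GRing.isLinear.Build K P P _ (lower i) (@lower_is_linear i).

Lemma lowerD i : {morph lower i : p q / p + q}. Proof. exact: raddfD. Qed.
Lemma lowerB i : {morph lower i : p q / p - q}. Proof. exact: raddfB. Qed.
Lemma lowerZ i a p : lower i (a *: p) = a *: lower i p. Proof. exact: linearZ. Qed.

Lemma jm_is_linear i : linear (jm i).
Proof.
move=> a p q; rewrite jm.unlock scaler_sumr -big_split /=.
by apply: eq_bigr => k _; rewrite msymD msymZ.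
Qed.

HB.instance Definition _ i :=
  GRing.isLinear.Build K P P _ (jm i) (@jm_is_linear i).

Lemma jmD i : {morph jm i : p q / p + q}. Proof. exact: raddfD. Qed.
Lemma jmB i : {morph jm i : p q / p - q}. Proof. exact: raddfB. Qed.
Lemma jmZ i a p : jm i (a *: p) = a *: jm i p. Proof. exact: linearZ. Qed.

Lemma ham_is_linear i : linear (ham i).
Proof.
move=> a p q; rewrite ham.unlock !(eulerD, eulerZ, jmD, jmZ, lowerD, lowerZ).
by rewrite -!mul_mpolyC; ring.
Qed.

HB.instance Definition _ i :=
  GRing.isLinear.Build K P P _ (ham i) (@ham_is_linear i).

Lemma hamB i : {morph ham i : p q / p - q}. Proof. exact: raddfB. Qed.
Lemma hamZ i a p : ham i (a *: p) = a *: ham i p. Proof. exact: linearZ. Qed.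

Lemma msym_euler t i p : msym t (euler i p) = euler (t i) (msym t p).
Proof. by rewrite euler.unlock msymM msymXU msym_dunkl. Qed.

Lemma msym_lower t i p : msym t (lower i p) = lower (t i) (msym t p).
Proof. by rewrite lower.unlock msym_dunkl msymD msymZ msym_euler. Qed.

Lemma msym_jm t i p : t i = i -> (forall k, (t k < i)%N = (k < i)%N) ->
  msym t (jm i p) = jm i (msym t p).
Proof.
move=> ti tlt; rewrite jm.unlock [LHS](raddf_sum (msym t)) /= [in RHS](reindex_inj (@perm_inj _ t)) /=.
apply: eq_big => [k|k _]; first by rewrite tlt.
by rewrite (msym_s t i k p) ti.
Qed.

Lemma msym_ham t i p : t i = i -> (forall k, (t k < i)%N = (k < i)%N) ->
  msym t (ham i p) = ham i (msym t p).
Proof.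
by move=> ti tlt; rewrite ham.unlock msymB msymD msymZ msym_euler msym_lower msym_jm // ti.
Qed.

(** Moving ['X_i] to the right of [dunkl j] costs one swap, and that swap turns the remaining
    [dunkl i] into [dunkl j]. *)
Lemma euler_dunkl i j p : i != j ->
  euler i (d j p) = d j (euler i p) + b *: d j (s i j p).
Proof.
move=> ij; rewrite euler.unlock dunklXM_neq 1?eq_sym // (s_C j i) dunkl_s1 dunklC.
by rewrite subrK.
Qed.

(** The defect of commutation is what the Jucys-Murphy term of the larger index will compensate in
    [ham]. *)
Lemma euler_euler i j p : i != j ->
  euler i (euler j p) = euler j (euler i p)
    + b *: (euler j (s i j p) - euler i (s i j p)).
Proof.
move=> ij; rewrite euler.unlock !dunklXM_neq // 1?eq_sym // (s_C j i).
by rewrite dunkl_s1 dunkl_s2 (dunklC b i j) -!mul_mpolyC; ring.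
Qed.

Lemma euler_lower i j p : i != j ->
  euler i (lower j p) = lower j (euler i p) + b *: lower j (s i j p).
Proof.
move=> ij; rewrite lower.unlock euler_dunkl // -!dunklZ -!dunklD; congr (d j _).
rewrite eulerD eulerZ euler_euler // msymD msymZ msym_euler tpermR.
by rewrite -!mul_mpolyC; ring.
Qed.

Lemma lowerC i j p : lower i (lower j p) = lower j (lower i p).
Proof.
have [->//|ij] := eqVneq i j; have ji : j != i by rewrite eq_sym.
(* [Q k l] is what remains of [lower k (lower l p)] once both Dunkl operators are pulled to the
   left. These commute, so it suffices that [Q] is symmetric in its indices, which [euler_euler]
   gives. *)
pose Q (k l : 'I_n) := euler k (euler l p) + c *: (euler l p + euler k p)
  + (c * c) *: p + b *: (euler k (s k l p)) + (b * c) *: s k l p.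
have E (k l : 'I_n) : k != l -> lower k (lower l p) = d k (d l (Q k l)).
  move=> kl; rewrite lower.unlock euler_dunkl // -!dunklZ -!dunklD.
  congr (d k (d l _)).
  rewrite !(eulerD, eulerZ, msymD, msymZ) msym_euler tpermR /Q -!scalerA -!mul_mpolyC.
  ring.
have QC : Q i j = Q j i.
  rewrite /Q (euler_euler p ij) (s_C j i) -!scalerA -!mul_mpolyC; ring.
by rewrite (E i j ij) (E j i ji) QC (dunklC b i j).
Qed.

Lemma jmE i p : jm i p = \sum_(k < n | (k < i)%N) s i k p.
Proof. by rewrite jm.unlock. Qed.

Lemma tperm_lt (i j k l : 'I_n) : (i < l)%N -> (j < l)%N ->
  (tperm i j k < l)%N = (k < l)%N.
Proof. by move=> il jl; case: tpermP => // ->; rewrite il jl. Qed.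

Lemma tperm_gt (i j k l : 'I_n) : (l <= i)%N -> (l <= j)%N ->
  (tperm i j k < l)%N = (k < l)%N.
Proof. by move=> il jl; case: tpermP => // ->; rewrite !ltnNge il jl. Qed.

(** For [i < j] the swaps in [jm i] fix [j], so [jm i] passes through everything indexed by [j]. The
    one swap of [jm j] that involves [i] produces corrections cancelling those of [euler_euler] and
    [euler_lower]. *)
Lemma ham_commute_lt i j p : (i < j)%N -> ham i (ham j p) = ham j (ham i p).
Proof.
move=> lt_ij; have ij : i != j by rewrite neq_ltn lt_ij.
have ji : j != i by rewrite eq_sym.
have tj k : (k < i)%N -> tperm i k j = j.
  by move=> ki; rewrite tpermD // neq_ltn ?lt_ij // (ltn_trans ki).
have jm_t (F : 'I_n -> P -> P) q : (forall t q, msym t (F j q) = F (t j) (msym t q)) ->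
    {morph F j : p q / p + q} -> jm i (F j q) = F j (jm i q).
  move=> tF FD; have F0 : F j 0 = 0.
    by have /eqP := FD 0 0; rewrite addr0 -subr_eq subrr eq_sym => /eqP.
  rewrite jm.unlock (big_morph (F j) FD F0).
  by apply: eq_bigr => k ki; rewrite tF tj.
have jm_e q : jm i (euler j q) = euler j (jm i q).
  by apply: jm_t => *; [exact: msym_euler|exact: eulerD].
have jm_l q : jm i (lower j q) = lower j (jm i q).
  by apply: jm_t => *; [exact: msym_lower|exact: lowerD].
have jm_jm q : jm i (jm j q) = jm j (jm i q).
  rewrite !(jmE i) [RHS](raddf_sum (jm j)) /=; apply: eq_bigr => k ki.
  rewrite msym_jm ?tj // => l.
  by apply: tperm_lt => //; exact: ltn_trans ki lt_ij.
(* Apart from its [i]-th term, the Jucys-Murphy sum at [j] commutes with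
   whatever is indexed by [i]. *)
have jm_comm (F : 'I_n -> P -> P) q : (forall t q, msym t (F i q) = F (t i) (msym t q)) ->
    {morph F i : p q / p + q} ->
    jm j (F i q) = F i (jm j q) + s i j (F i q) - F i (s i j q).
  move=> tF FD; have F0 : F i 0 = 0.
    by have /eqP := FD 0 0; rewrite addr0 -subr_eq subrr eq_sym => /eqP.
  rewrite jm.unlock (big_morph (F i) FD F0) (bigD1 i) //= [in RHS](bigD1 i) //=.
  rewrite (s_C j i (F i q)) (s_C j i q) [X in _ + X = _](eq_bigr (fun k => F i (s j k q))); first by ring.
  by move=> k /andP[_ ki]; rewrite tF tpermD.
have jme q : jm j (euler i q) = euler i (jm j q) + euler j (s i j q) - euler i (s i j q).
  have -> := jm_comm (fun k => euler k) q (fun t r => msym_euler t i r) (@eulerD i).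
  by rewrite msym_euler tpermL.
have jml q : jm j (lower i q) = lower i (jm j q) + lower j (s i j q) - lower i (s i j q).
  have -> := jm_comm (fun k => lower k) q (fun t r => msym_lower t i r) (@lowerD i).
  by rewrite msym_lower tpermL.
rewrite ham.unlock !(eulerB, eulerD, eulerZ, lowerB, lowerD, lowerZ, jmB, jmD, jmZ).
rewrite jm_e jm_l jm_jm jme jml (lowerC i j) (euler_euler p ij).
rewrite (euler_lower p ij) (euler_lower p ji) (s_C j i).
by rewrite -!mul_mpolyC; ring.
Qed.

Lemma hamC i j p : ham i (ham j p) = ham j (ham i p).
Proof.
have [/ham_commute_lt->//|/ham_commute_lt->//|/val_inj->//] := ltngtP i j.
Qed.

(** Degenerate Hecke relation: conjugating [jm i] by the swap gives [jm j] without its term at [i],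
    and that missing term, the swap applied twice, is the identity. *)
Lemma swap_ham1 i j p : (j = i.+1 :> nat) ->
  s i j (ham i p) = ham j (s i j p) - b *: p.
Proof.
move=> ji; have lt_ij : (i < j)%N by rewrite ji.
rewrite ham.unlock msymB msymD msymZ msym_euler msym_lower tpermL.
suff -> : s i j (jm i p) = jm j (s i j p) - p by rewrite -!mul_mpolyC; ring.
rewrite jm.unlock [LHS](raddf_sum (msym _)) /= [in RHS](bigD1 i) //= (s_C j i) s_K addrAC subrr add0r.
apply: eq_big => k; first by rewrite ji ltnS ltn_neqAle andbC.
move=> ki; rewrite msym_s tpermL tpermD // neq_ltn ?ki ?orbT //.
by rewrite (ltn_trans ki) // orbT.
Qed.

Lemma swap_ham2 i j p : (j = i.+1 :> nat) ->
  s i j (ham j p) = ham i (s i j p) + b *: p.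
Proof.
move=> ji; have := swap_ham1 (s i j p) ji; rewrite s_K => /(congr1 (s i j)).
by rewrite s_K msymB msymZ s_K => ->; rewrite subrK.
Qed.

(** Since [i] and [j] are adjacent, both or neither lie below [k], so the swap only permutes the
    terms of [jm k]. *)
Lemma swap_ham i j k p : (j = i.+1 :> nat) -> k != i -> k != j ->
  s i j (ham k p) = ham k (s i j p).
Proof.
move=> ji ki kj; apply: msym_ham => [|l]; first by rewrite tpermD // eq_sym.
have [ik|ik] := leqP k i; first by apply: tperm_gt; rewrite // ji leqW.
apply: tperm_lt => //; move: kj; rewrite -(inj_eq val_inj) /= ji => kj.
by rewrite ltn_neqAle eq_sym kj.
Qed.

End Hamiltonian.

(** * Polynomials in the Hamiltonians *)

Section LinearExtension.
Context (n : nat) (K : nzRingType) (V : lmodType K) (phi : 'X_{1..n} -> V).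
Implicit Types p q : {mpoly K[n]}.

Definition mext p : V := \sum_(m <- msupp p) p@_m *: phi m.

(** A common degree bound gives one index set for several polynomials, which linearity of [mext]
    needs because their supports differ. *)
Lemma mextwE k p : (msize p <= k)%N ->
  mext p = \sum_(m : 'X_{1..n < k}) p@_m *: phi m.
Proof.
move=> le_pk; pose I : subFinType _ := 'X_{1..n < k}.
rewrite /mext (ssrcomplements.big_mksub I) ?msupp_uniq //=; last first.
  by move=> m /msize_mdeg_lt/leq_trans; apply.
by rewrite big_rmcond //= => m /memN_msupp_eq0 ->; rewrite scale0r.
Qed.

Lemma mext_is_linear : linear mext.
Proof.
move=> c p q; pose k := maxn (msize (c *: p + q)) (maxn (msize p) (msize q)).
rewrite !(@mextwE k) ?leq_max ?leqnn ?orbT // scaler_sumr -big_split /=.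
by apply: eq_bigr => m _; rewrite mcoeffD mcoeffZ scalerDl scalerA.
Qed.

HB.instance Definition _ :=
  GRing.isLinear.Build K {mpoly K[n]} V _ mext mext_is_linear.

Lemma mextX m : mext 'X_[m] = phi m.
Proof. by rewrite /mext msuppX big_seq1 mcoeffX eqxx scale1r. Qed.
End LinearExtension.

(** Evaluation of [p] at a family of operators. The fold fixes an order of the variables, which is
    immaterial once the operators commute. *)
HB.lock Definition polyact n (K : comNzRingType) (V : lmodType K) (H : 'I_n -> V -> V)
    (p : {mpoly K[n]}) (v : V) : V :=
  mext (fun m => foldr (fun i => iter (m i) (H i)) v (enum 'I_n)) p.

Section PolyAct.
Context (n : nat) (K : comNzRingType) (V : lmodType K).
Context (H : 'I_n -> {linear V -> V}).
Context (HC : forall i j v, H i (H j v) = H j (H i v)).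
Local Notation act := (polyact H).
Implicit Types (p q : {mpoly K[n]}) (v w : V).

Lemma polyactDl p q v : act (p + q) v = act p v + act q v.
Proof. by rewrite polyact.unlock raddfD. Qed.

Lemma polyactZl c p v : act (c *: p) v = c *: act p v.
Proof. by rewrite polyact.unlock linearZ. Qed.

Lemma polyact0l v : act 0 v = 0.
Proof. by rewrite polyact.unlock raddf0. Qed.

Lemma polyactNl p v : act (- p) v = - act p v.
Proof. by rewrite polyact.unlock raddfN. Qed.

Lemma polyact1 v : act 1 v = v.
Proof.
rewrite polyact.unlock -mpolyX0 mextX.
by elim: (enum _) => //= i r ->; rewrite mnm0E.
Qed.

(** The membership test serves as an iteration count, so that the induction also covers the tails of
    [r] in which [i] does not occur. *)
Lemma foldr_iterU i (m : 'X_{1..n}) v (r : seq 'I_n) : uniq r ->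
  foldr (fun k => iter ((U_(i) + m)%MM k) (H k)) v r =
  iter (i \in r) (H i) (foldr (fun k => iter (m k) (H k)) v r).
Proof.
have iterC k j l w : iter k (H j) (H l w) = H l (iter k (H j) w).
  by elim: k => //= k ->; rewrite HC.
elim: r => //= j r IH /andP[jr ur]; rewrite IH // mnmDE mnm1E in_cons.
have [->|ij] := eqVneq i j; first by rewrite (negPf jr) /= -iterC.
by rewrite add0n /=; case: (i \in r) => //=; rewrite iterC.
Qed.

Lemma polyactXM i p v : act ('X_i * p) v = H i (act p v).
Proof.
rewrite polyact.unlock; set phi := fun m : 'X_{1..n} => _.
rewrite [p]mpolyE mulr_sumr !(raddf_sum (mext phi)) (raddf_sum (H i)) /=.
apply: eq_bigr => m _.
rewrite -scalerAr -mpolyXD !linearZ_LR /=; congr (_ *: _).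
by rewrite !mextX /phi foldr_iterU ?enum_uniq // mem_enum.
Qed.

Lemma polyactH i p v : act p (H i v) = H i (act p v).
Proof.
elim/mpoly_indXM: p => [|p q Ep Eq|c p E|j p E].
- by rewrite !polyact1.
- by rewrite !polyactDl Ep Eq raddfD.
- by rewrite !polyactZl E linearZ_LR.
- by rewrite !polyactXM E HC.
Qed.

Lemma polyactDr p v w : act p (v + w) = act p v + act p w.
Proof.
elim/mpoly_indXM: p => [|p q Ep Eq|c p E|j p E].
- by rewrite !polyact1.
- by rewrite !polyactDl Ep Eq addrACA.
- by rewrite !polyactZl E scalerDr.
- by rewrite !polyactXM E raddfD.
Qed.

Lemma polyactNr p v : act p (- v) = - act p v.
Proof.
apply/eqP; rewrite -addr_eq0 -polyactDr addNr; apply/eqP.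
by apply: (addrI (act p 0)); rewrite -polyactDr !addr0.
Qed.

Lemma polyactMl p q v : act (p * q) v = act p (act q v).
Proof.
elim/mpoly_indXM: p => [|p r Ep Eq|c p E|j p E].
- by rewrite mul1r polyact1.
- by rewrite mulrDl !polyactDl Ep Eq.
- by rewrite -scalerAl !polyactZl E.
- by rewrite -mulrA !polyactXM E.
Qed.
End PolyAct.

(** * Adjacent transpositions and the Vandermonde product *)

Section Permutations.
Context (n : nat) (K : idomainType).
Local Notation P := {mpoly K[n]}.

(* Adjacent transpositions generate the symmetric group. *)
Lemma perm_ind_adjacent (Q : 'S_n -> Prop) :
  Q 1%g -> (forall s t, Q s -> Q t -> Q (s * t)%g) ->
  (forall i j : 'I_n, (j = i.+1 :> nat) -> Q (tperm i j)) -> forall t, Q t.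
Proof.
move=> Q1 QM Qa t.
have Qlt d (i j : 'I_n) : (j = i + d :> nat)%N -> Q (tperm i j).
  elim: d j => [|d IH] j ji.
    by rewrite (_ : j = i) ?tperm1 //; apply: val_inj; rewrite /= ji addn0.
  (* Induction on the gap: with [k = j - 1], the swap of [i] and [j] is the swap of [i] and [k]
     conjugated by an adjacent one. *)
  have kn : (i + d < n)%N by rewrite (leq_trans _ (ltn_ord j)) // ji addnS.
  pose k := Ordinal kn; have jk : (j = k.+1 :> nat) by rewrite ji addnS.
  have [->|ik] := eqVneq i k; first exact: Qa.
  have ij : j != i by rewrite -(inj_eq val_inj) /= ji -{2}[val i]addn0 eqn_add2l.
  have kj : k != j by rewrite -(inj_eq val_inj) /= ji addnS neq_ltn ltnSn.
  have -> : tperm i j = (tperm j k * tperm i k * tperm j k)%g.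
    by rewrite -{1}(tpermV j k) -mulgA -conjgE tpermJ tpermR tpermD // eq_sym.
  by rewrite tpermC; apply/QM/Qa/jk; apply: QM; [exact: Qa|exact: IH].
have [ts -> _] := prod_tpermP t.
apply: (big_ind Q) => // -[i j] _ /=; case/orP: (leq_total i j) => [ij|ji].
  by apply: (Qlt (j - i)%N); rewrite subnKC.
by rewrite tpermC; apply: (Qlt (i - j)%N); rewrite subnKC.
Qed.

Definition vdm : P := \prod_(e : 'I_n * 'I_n | (e.1 < e.2)%N) ('X_e.1 - 'X_e.2).

Lemma prodrN_pairs (F : 'I_n * 'I_n -> P) :
  \prod_(e : 'I_n * 'I_n | (e.1 < e.2)%N) - F e =
  (-1) ^+ #|[pred e : 'I_n * 'I_n | (e.1 < e.2)%N]| *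
    \prod_(e : 'I_n * 'I_n | (e.1 < e.2)%N) F e.
Proof. by rewrite -prodrN; apply: eq_bigl. Qed.

(** Up to a global sign [vdm] is a Vandermonde determinant, whose factors are written in the
    opposite order; permuting the variables permutes its columns. *)
Lemma msym_vdm t : msym t vdm = (-1) ^+ t * vdm.
Proof.
pose M := Vandermonde n (\row_j 'X_j : 'rV[P]_n).
have vdmE : vdm = (-1) ^+ #|[pred e : 'I_n * 'I_n | (e.1 < e.2)%N]| * \det M.
  rewrite det_Vandermonde pair_big_dep /= -prodrN_pairs.
  by apply: eq_bigr => e _; rewrite opprB !mxE.
suff E : msym t (\det M) = (-1) ^+ t * \det M.
  by rewrite vdmE msymM rmorphXn /= msymN msym1 E mulrCA.
rewrite -det_map_mx (_ : map_mx _ _ = col_perm t M).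
  by rewrite col_permE det_mulmx det_perm odd_permV mulrC.
by apply/matrixP => i j; rewrite !mxE rmorphXn /= msymXU.
Qed.

Lemma vdm_neq0 : vdm != 0.
Proof.
apply/prodf_neq0 => e lt_e; apply: subX_neq0.
by rewrite neq_ltn lt_e.
Qed.

End Permutations.

(** * Degenerate Hecke relations for polynomials in the Hamiltonians, and their effect on an
    invariant pairing *)

Section Transfer.
Context (n : nat) (K : idomainType) (b c : K).
Local Notation P := {mpoly K[n]}.
Local Notation ham := (ham b c).
Local Notation act := (polyact ham).
Local Notation s i j := (@msym n K (tperm i j)).
Implicit Types (p q v : P).

Let XM i p v : act ('X_i * p) v = ham i (act p v).
Proof. exact: (polyactXM (@hamC n K b c)). Qed.
Let Dl p q v : act (p + q) v = act p v + act q v.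
Proof. exact: (polyactDl ham). Qed.
Let Zl a p v : act (a *: p) v = a *: act p v.
Proof. exact: (polyactZl ham). Qed.

(** Bernstein-Lusztig form of the Hecke relations: the defect in moving a swap through [p(ham)]
    obeys the Leibniz rule of the divided difference, so the relations for single variables extend
    to all polynomials. *)
Lemma swap_polyact (i j : 'I_n) p v : (j = i.+1 :> nat) ->
  s i j (act p v) = act (s i j p) (s i j v) - b *: act (divdiff i j p) v.
Proof.
move=> ji; have ij : i != j by rewrite -(inj_eq val_inj) /= ji neq_ltn ltnSn.
elim/mpoly_indXM: p => [|p q Ep Eq|a p E|k p E].
- have D1 : divdiff i j (1 : P) = 0 by apply: divdiff_sym0; rewrite ?msym1.
  by rewrite D1 msym1 !polyact1 (polyact0l ham) scaler0 subr0.
- by rewrite Dl !msymD Ep Eq raddfD /= !Dl scalerDr; ring.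
- by rewrite Zl !msymZ E divdiffZ !Zl scalerBr !scalerA mulrC.
(* The correction produced by [swap_ham1] and [swap_ham2] involves [p], while the claim involves
   [s i j p]; the two differ by ['X_i - 'X_j] times the divided difference. *)
have key : act p v = act (s i j p) v
    + (ham i (act (divdiff i j p) v) - ham j (act (divdiff i j p) v)).
  have {1}<- : s i j p + ('X_i * divdiff i j p + (-1) *: ('X_j * divdiff i j p)) = p.
    by rewrite scaleN1r -mulrBl -divdiffP addrC subrK.
  by rewrite !Dl Zl !XM scaleN1r.
rewrite XM divdiffXM // msymM s_X Dl !XM.
have [->|ki] := eqVneq k i.
  rewrite (negPf ij) tpermL (swap_ham1 _ _ _ ji) E hamB hamZ subr0 mul1r key.
  by rewrite -!mul_mpolyC; ring.
have [->|kj] := eqVneq k j.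
  rewrite tpermR (swap_ham2 _ _ _ ji) E hamB hamZ sub0r mulN1r.
  by rewrite (polyactNl ham) key -!mul_mpolyC; ring.
rewrite tpermD 1?eq_sym // (swap_ham _ _ _ ji ki kj) E hamB hamZ subrr mul0r.
by rewrite (polyact0l ham) addr0.
Qed.

Context (pair : P -> P -> K).
Context (pairC : forall f g, pair f g = pair g f).
Context (pairDr : forall f, {morph pair f : g h / g + h}).
Context (pairZr : forall f a g, pair f (a *: g) = a * pair f g).
Context (pair_msym : forall t f g, pair (msym t f) (msym t g) = pair f g).
Context (pair_ham : forall i f g, pair (ham i f) g = pair f (ham i g)).

Lemma pair_polyact p f g : pair (act p f) g = pair f (act p g).
Proof.
elim/mpoly_indXM: p f g => [|p q Ep Eq|a p E|k p E] f g.
- by rewrite !polyact1.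
- by rewrite !Dl pairDr (pairC _ g) pairDr (pairC g) Ep (pairC g) Eq.
- by rewrite !Zl pairZr (pairC _ g) pairZr (pairC g) E.
by rewrite !XM pair_ham E; congr (pair f _); rewrite (polyactH (@hamC n K b c)).
Qed.

Context (two_neq0 : 2%:R != 0 :> K).

(* Only the sign-isotypic part of [p] contributes to the pairing of [f] with
   [p(ham) g]: if [p] is invariant under [s i j], then [p(ham)] commutes with
   this swap, which fixes [f] and changes the sign of [g]. *)
Lemma pair_polyact_msym f g t p :
  (forall t, msym t f = f) -> (forall t, msym t g = (-1) ^+ t * g) ->
  pair f (act (msym t p) g) = (-1) ^+ t * pair f (act p g).
Proof.
move=> fsym gsym; have Nr h : pair f (- h) = - pair f h.
  by rewrite -scaleN1r pairZr mulN1r.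
elim/perm_ind_adjacent: t p => [|s1 s2 E1 E2|i j ji] p.
- by rewrite msym1m odd_perm1 mul1r.
- by rewrite msymMm E2 E1 mulrA odd_permM signr_addb [_ ^+ s2 * _]mulrC.
have ij : i != j by rewrite -(inj_eq val_inj) /= ji neq_ltn ltnSn.
rewrite odd_tperm ij expr1 mulN1r; apply/eqP; rewrite -addr_eq0 -pairDr -Dl.
set q := _ + p; have sq : s i j q = q by rewrite msymD s_K addrC.
(* The pairing with the symmetrised polynomial [q] will be shown equal to its own negative, hence
   the doubling. *)
apply/eqP; apply: (mulfI two_neq0); rewrite mulr0 mulr_natl mulr2n.
rewrite -{1}(pair_msym (tperm i j)).
rewrite (swap_polyact q g ji) sq (divdiff_sym0 ij sq) (polyact0l ham) scaler0 subr0.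
by rewrite gsym odd_tperm ij expr1 mulN1r (polyactNr (@hamC n K b c)) fsym Nr addNr.
Qed.

(** The order-reversing permutation [w] exchanges the two variables of each factor, up to
    relabelling the pairs. This flips the sign of [a] at the price of one sign per pair, and
    [(-1) ^+ w] is the product of these signs. *)
Lemma pair_polyact_factors f g (a : K) :
  (forall t, msym t f = f) -> (forall t, msym t g = (-1) ^+ t * g) ->
  pair f (act (\prod_(e : 'I_n * 'I_n | (e.1 < e.2)%N) (a%:MP - 'X_e.1 + 'X_e.2)) g) =
  pair f (act (\prod_(e : 'I_n * 'I_n | (e.1 < e.2)%N) (- a%:MP - 'X_e.1 + 'X_e.2)) g).
Proof.
move=> fsym gsym; pose w : 'S_n := perm (@rev_ord_inj n).
have rev (F : 'I_n -> 'I_n -> P) :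
    \prod_(e : 'I_n * 'I_n | (e.1 < e.2)%N) F (w e.1) (w e.2) =
    \prod_(e : 'I_n * 'I_n | (e.1 < e.2)%N) F e.2 e.1.
  (* Reversing both entries and exchanging them preserves the condition [e.1 < e.2]. *)
  have hK : involutive (fun e : 'I_n * 'I_n => (rev_ord e.2, rev_ord e.1)).
    by move=> [i j]; rewrite /= !rev_ordK.
  rewrite (reindex_inj (inv_inj hK)) /=.
  apply: eq_big => [[i j]|[i j] _]; last by rewrite /= !permE !rev_ordK.
  by have := ltn_ord i; have := ltn_ord j; rewrite /=; lia.
set k := #|[pred e : 'I_n * 'I_n | (e.1 < e.2)%N]|.
(* The sign of [w] is read off from its action on the nonzero [vdm], whose factors it negates one by
   one. *)
have sgn_w : (-1) ^+ w = (-1) ^+ k :> P.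
  apply: (mulIf (vdm_neq0 n K)); rewrite -msym_vdm [LHS]rmorph_prod /=.
  under eq_bigr do rewrite msymB !msymXU.
  rewrite (rev (fun i j => 'X_i - 'X_j)) -prodrN_pairs.
  by apply: eq_bigr => e _; rewrite opprB.
have {}sgn_w : (-1) ^+ w = (-1) ^+ k :> K.
  by apply: (can_inj (@mpolyCK n K)); rewrite !rmorphXn /= !rmorphN1.
set Y := \prod_(e : _ | _) (a%:MP - _ + _).
have -> : \prod_(e : 'I_n * 'I_n | (e.1 < e.2)%N) (- a%:MP - 'X_e.1 + 'X_e.2) =
    (-1) ^+ k *: msym w Y.
  rewrite [msym w Y]rmorph_prod /=.
  under [in RHS]eq_bigr do rewrite msymD msymB !msymXU msymC.
  rewrite (rev (fun i j => a%:MP - 'X_i + 'X_j)) -mul_mpolyC rmorphXn rmorphN1 /=.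
  rewrite -prodrN_pairs; apply: eq_bigr => e _; ring.
by rewrite Zl pairZr pair_polyact_msym // sgn_w mulrA -signr_odd -signr_addb addbb mul1r.
Qed.
End Transfer.

(** * The Laguerre pairing *)

Section LogDerivative.
Context (n : nat) (K : idomainType).
Local Notation P := {mpoly K[n]}.
Implicit Types (p q : P) (j k : 'I_n).

Lemma mderivXE j p (k : nat) : (p ^+ k)^`M(j) = (p ^+ k.-1 * p^`M(j)) *+ k.
Proof.
elim: k => [|k IH]; first by rewrite expr0 -mpolyC1 mderivC.
case: k IH => [_|k IH]; rewrite exprS mderivM.
  by rewrite expr0 -mpolyC1 mderivC mulr0 addr0 mulr1 mul1r.
rewrite IH /= exprS; ring.
Qed.

(* [Q k] is the quotient of the product by ['X_j - 'X_k], counted as often as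
   that linear form occurs, up to sign, among the factors. *)
Lemma mderiv_prod_subX j (r : seq ('I_n * 'I_n)) :
  all (fun e => e.1 != e.2) r ->
  exists Q : 'I_n -> P,
    (forall k, k != j -> ('X_j - 'X_k) * Q k =
       (count_mem (j, k) r + count_mem (k, j) r)%:R *
         \prod_(e <- r) ('X_e.1 - 'X_e.2)) /\
    (\prod_(e <- r) ('X_e.1 - 'X_e.2))^`M(j) = \sum_(k < n | k != j) Q k.
Proof.
elim: r => [|[u v] r IH] /=.
  move=> _; exists (fun=> 0); split => [k _|]; first by rewrite mulr0 mul0r.
  by rewrite big_nil -mpolyC1 mderivC big1.
move=> /andP[uv /IH[Q [Q1 Q2]]]; set F := \prod_(e <- r) _ in Q1 Q2.
(* Product rule for the new factor: the old quotients are multiplied by it, and its own derivative,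
   nonzero only if [j] is [u] or [v], adds plus or minus [F] to the quotient at the other index. *)
exists (fun k => ('X_u - 'X_v) * Q k
  + (((u, v) == (j, k))%:R - ((u, v) == (k, j))%:R) * F); split.
  move=> k kj; rewrite big_cons -/F mulrDr mulrCA Q1 // !natrD !xpair_eqE.
  have [->|uj] := eqVneq u j; have [->|vj] := eqVneq v j; rewrite /= ?andbT ?andbF /=.
  - by ring.
  - by rewrite eq_sym; case: eqVneq => [->|_] /=; ring.
  - by case: eqVneq => [->|_] /=; ring.
  - by ring.
rewrite big_cons -/F mderivM Q2 mderivB !mderivXU big_split /= -mulr_sumr addrC.
congr (_ + _); rewrite -mulr_suml; congr (_ * _); rewrite sumrB; congr (_ - _).
  have [ju|ju] := eqVneq j u.
    rewrite (bigD1 v) /= ?ju 1?eq_sym // eqxx big1 ?addr0 // => k /andP[_ kv].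
    by rewrite xpair_eqE [v == k]eq_sym (negPf kv) andbF.
  by rewrite big1 // => k _; rewrite xpair_eqE [u == j]eq_sym (negPf ju).
have [jv|jv] := eqVneq j v.
  rewrite (bigD1 u) /= ?jv // eqxx big1 ?addr0 // => k /andP[_ ku].
  by rewrite xpair_eqE [u == k]eq_sym (negPf ku).
by rewrite big1 // => k _; rewrite xpair_eqE [v == j]eq_sym (negPf jv) andbF.
Qed.

(** Logarithmic derivative without fractions: [Q k] stands for [vdm / ('X_j - 'X_k)], and exactly
    one of [(j, k)], [(k, j)] is listed among the factors. *)
Lemma mderiv_vdm j : exists Q : 'I_n -> P,
  (forall k, k != j -> ('X_j - 'X_k) * Q k = vdm n K) /\
  (vdm n K)^`M(j) = \sum_(k < n | k != j) Q k.
Proof.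
pose r := [seq e : 'I_n * 'I_n <- index_enum _ | (e.1 < e.2)%N].
have vdmE : vdm n K = \prod_(e <- r) ('X_e.1 - 'X_e.2).
  by rewrite big_filter.
have [|Q [Q1 Q2]] := @mderiv_prod_subX j r.
  by apply/allP => e; rewrite mem_filter => /andP[lt_e _]; rewrite neq_ltn lt_e.
exists Q; rewrite vdmE; split=> // k kj; rewrite Q1 //.
have ur : uniq r by rewrite filter_uniq ?index_enum_uniq.
rewrite !(count_uniq_mem _ ur) /r !mem_filter !mem_index_enum /= !andbT.
move: kj; rewrite -(inj_eq val_inj) /=; case: ltngtP => // _ _; exact: mul1r.
Qed.

End LogDerivative.

(** Algebraic stand-in for integration against a product of one-variable weights; the Vandermonde
    power stays inside the polynomial. *)
HB.lock Definition moment n (K : comNzRingType) (mu : nat -> K) (p : {mpoly K[n]}) : K :=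
  mext (V := K^o) (fun m => \prod_i mu (m i)) p.

Section Pairing.
Context (n : nat) (K : idomainType) (a : K) (mu : nat -> K).
Context (muS : forall k, mu k.+1 = (k%:R + a) * mu k).
Context (beta : nat).
Local Notation P := {mpoly K[n]}.
Local Notation s i j := (@msym n K (tperm i j)).
Local Notation b := (beta%:R : K).
Local Notation W := (vdm n K ^+ (2 * beta)).
Implicit Types (p q f g : P) (i j k : 'I_n).

Local Notation M := (moment mu).

Lemma momentD p q : M (p + q) = M p + M q.
Proof. by rewrite moment.unlock raddfD. Qed.
Lemma momentB p q : M (p - q) = M p - M q.
Proof. by rewrite moment.unlock raddfB. Qed.
Lemma momentZ c p : M (c *: p) = c * M p.
Proof. by rewrite moment.unlock linearZ. Qed.
Lemma moment_sum (I : finType) (Q : pred I) (F : I -> P) :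
  M (\sum_(k | Q k) F k) = \sum_(k | Q k) M (F k).
Proof. by rewrite moment.unlock raddf_sum. Qed.
Lemma momentX (m : 'X_{1..n}) : M 'X_[m] = \prod_i mu (m i).
Proof. by rewrite moment.unlock mextX. Qed.

Lemma moment_msym t p : M (msym t p) = M p.
Proof.
elim/mpolyind: p => [|c m p _ _ E]; first by rewrite msym0.
rewrite msymD msymZ !momentD !momentZ E msymX !momentX; congr (_ * _ + _).
rewrite [RHS](reindex_inj (@perm_inj _ (t^-1)%g)) /=.
by apply: eq_bigr => i _; rewrite mnmE.
Qed.

(** One-variable integration by parts for the Laguerre weight. On a monomial it is the recursion
    [muS]; at exponent 0 the derivative vanishes and both sides are zero. *)
Lemma moment_euler j p : M ('X_j * p^`M(j)) = M (('X_j - a%:MP) * p).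
Proof.
elim/mpolyind: p => [|c m p _ _ E]; first by rewrite mderiv0 !mulr0.
rewrite mderivD mderivZ !mulrDr !momentD E; congr (_ + _).
rewrite -!scalerAr !momentZ; congr (_ * _).
rewrite mulrBl momentB mul_mpolyC momentZ mderivX -scalerAr momentZ -!mpolyXD !momentX.
rewrite (bigD1 j) //= [X in _ = X - _](bigD1 j) //= [X in _ = _ - _ * X](bigD1 j) //=.
have offj (m' : 'X_{1..n}) k : k != j -> (U_(j) + m')%MM k = m' k.
  by rewrite mnmDE mnm1E eq_sym => /negPf ->.
under eq_bigr => k kj do rewrite offj // mnmBE mnm1E eq_sym (negPf kj) subn0.
under [X in _ = _ * X - _]eq_bigr => k kj do rewrite offj //.
rewrite !mnmDE mnmBE !mnm1E eqxx !add1n subn1.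
by case: (m j) => [|k] /=; rewrite !muS; ring.
Qed.

(** This is [dunkl j] after multiplication by ['X_j], plus [a - 1]: the factor left when a Dunkl
    operator is split off [lower] on the right. *)
Definition raise j p : P := euler b j p + b *: sumswap j p + a *: p.

Lemma lower_raise j p : lower b (a - 1) j p = raise j (dunkl b j p).
Proof.
rewrite lower.unlock dunklD dunklZ {1}euler.unlock dunklXM_eq /raise euler.unlock.
by rewrite scalerBl scale1r; ring.
Qed.

Lemma msym_even_vdm t : msym t W = W.
Proof.
by rewrite rmorphXn /= msym_vdm exprMn [X in X * _]exprM sqrr_sign expr1n mul1r.
Qed.

(* Integration by parts in the variable [j], with weight [W]. *)
Lemma moment_raise j p q :
  M (W * 'X_j * p * (q - dunkl b j q)) = M (W * q * raise j p).
Proof.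
have [Q [Q1 Q2]] := mderiv_vdm K j.
(* [r k] is [b * W / ('X_j - 'X_k)] as a polynomial. For [beta = 0] the truncated exponent is
   harmless because [b = 0]. *)
pose r k := b *: (vdm n K ^+ (2 * beta).-1 * Q k).
have rE k : k != j -> ('X_j - 'X_k) * r k = b *: W.
  move=> kj; rewrite /r -scalerAr mulrCA Q1 // -exprSr.
  by case: (beta) => [|m]; rewrite ?scale0r // mulnS.
have dW : W^`M(j) = \sum_(k < n | k != j) r k *+ 2.
  rewrite mderivXE Q2 mulr_sumr -sumrMnl; apply: eq_bigr => k _.
  by rewrite /r scaler_nat -mulrnA mulnC.
clearbody r.
have sr k : k != j -> s j k (r k) = - r k.
  move=> kj; have jk : j != k by rewrite eq_sym.
  apply: (mulfI (subX_neq0 K jk)); rewrite mulrN rE //.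
  have := congr1 (s j k) (rE k kj); rewrite msymM msymB !s_X tpermL tpermR.
  by rewrite msymZ msym_even_vdm => <-; rewrite -mulNr opprB.
(* [E k] gathers the terms indexed by [k] in the difference of the two sides. It has the form
   [h - s j k h] with [h = 'X_j * r k * p * s j k q], so its moment is zero; what remains is
   [moment_euler] for [W * p * q]. *)
pose E k := 2%:R * 'X_j * p * q * r k
  - (b%:MP * W * 'X_j * p * divdiff j k q + b%:MP * W * 'X_j * q * divdiff j k p
     + b%:MP * W * q * s j k p).
have ME k : k != j -> M (E k) = 0.
  move=> kj; have -> : E k = 'X_j * r k * p * s j k q - s j k ('X_j * r k * p * s j k q).
    have bW x y : b%:MP * W * 'X_j * x * divdiff j k y = 'X_j * r k * x * (y - s j k y).
      by rewrite divdiffP mul_mpolyC -(rE k kj); ring.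
    by rewrite !msymM s_K s_X tpermL sr // /E !bW mul_mpolyC -(rE k kj); ring.
  by rewrite momentB moment_msym subrr.
have SE : \sum_(k < n | k != j) E k = 2%:R * 'X_j * p * q * (\sum_(k < n | k != j) r k)
  - (b%:MP * W * 'X_j * p * (\sum_(k < n | k != j) divdiff j k q)
     + b%:MP * W * 'X_j * q * (\sum_(k < n | k != j) divdiff j k p)
     + b%:MP * W * q * sumswap j p).
  by rewrite /E sumrB !big_split /= -!mulr_sumr.
have {}ME : M (\sum_(k < n | k != j) E k) = 0 by rewrite moment_sum big1.
have := moment_euler j (W * p * q); move/eqP; rewrite -subr_eq0 -momentB => /eqP D.
apply/eqP; rewrite -subr_eq0 -momentB -[0]subr0 -{1}ME -D -momentB; apply/eqP.
congr M; rewrite SE !mderivM dW sumrMnl /raise euler.unlock dunkl.unlock -!mul_mpolyC.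
ring.
Qed.

Definition pairing f g : K := M (f * g * W).

Lemma pairingC f g : pairing f g = pairing g f.
Proof. by rewrite /pairing [f * g]mulrC. Qed.

Lemma pairingDr f : {morph pairing f : g h / g + h}.
Proof. by move=> g h; rewrite /pairing mulrDr mulrDl momentD. Qed.

Lemma pairingZr f c g : pairing f (c *: g) = c * pairing f g.
Proof. by rewrite /pairing -scalerAr -scalerAl momentZ. Qed.

Lemma pairing_msym t f g : pairing (msym t f) (msym t g) = pairing f g.
Proof. by rewrite /pairing -{1}(msym_even_vdm t) -!msymM moment_msym. Qed.

(** Integration by parts merges the [euler] and [lower] parts into a form visibly symmetric in [f]
    and [g], so self-adjointness is left only for [jm]. *)
Lemma pairing_hamE i f g : pairing (ham b (a - 1) i f) g =
  b * pairing (jm i f) g + M (W * 'X_i * dunkl b i f * dunkl b i g).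
Proof.
rewrite /pairing ham.unlock lower_raise mulrBl mulrBl momentB.
have <- : M (W * g * raise i (dunkl b i f)) = M (raise i (dunkl b i f) * g * W).
  by congr M; ring.
rewrite -moment_raise -momentB -momentZ -momentD; congr M.
by rewrite euler.unlock -!mul_mpolyC; ring.
Qed.

Lemma pairing_jm i f g : pairing (jm i f) g = pairing f (jm i g).
Proof.
rewrite !jmE /pairing !mulr_suml !mulr_sumr mulr_suml !moment_sum.
apply: eq_bigr => k _; rewrite -[LHS](moment_msym (tperm i k)) !msymM s_K.
by rewrite msym_even_vdm.
Qed.

Lemma pairing_ham i f g :
  pairing (ham b (a - 1) i f) g = pairing f (ham b (a - 1) i g).
Proof.
rewrite [RHS]pairingC !pairing_hamE pairing_jm [pairing (jm _ g) _]pairingC.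
by congr (_ + M _); ring.
Qed.

End Pairing.

(** * Restriction of the type B operators to even polynomials *)

HB.lock Definition squares (R : realType) n (p : {mpoly R[i][n]}) : {mpoly R[i][n]} :=
  p \mPo [tuple zvar R i ^+ 2 | i < n].

Section EvenPolynomials.
Context (R : realType) (n : nat).
Local Notation P := {mpoly R[i][n]}.
Local Notation iota := (@squares R n).
Local Notation z := (@zvar R n).
Implicit Types (p q : P) (i j k : 'I_n).

Lemma squaresD p q : iota (p + q) = iota p + iota q.
Proof. by rewrite squares.unlock comp_mpolyD. Qed.
Lemma squaresB p q : iota (p - q) = iota p - iota q.
Proof. by rewrite squares.unlock comp_mpolyB. Qed.
Lemma squaresZ c p : iota (c *: p) = c *: iota p.
Proof. by rewrite squares.unlock comp_mpolyZ. Qed.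
Lemma squares0 : iota 0 = 0.
Proof. by rewrite squares.unlock comp_mpoly0. Qed.
Lemma squares1 : iota 1 = 1.
Proof. by rewrite squares.unlock comp_mpoly1. Qed.
Lemma squaresM p q : iota (p * q) = iota p * iota q.
Proof. by rewrite squares.unlock rmorphM. Qed.
Lemma squaresX i : iota 'X_i = z i ^+ 2.
Proof. by rewrite squares.unlock comp_mpolyXU -tnth_nth tnth_mktuple. Qed.
Lemma squares_sum (I : finType) (Q : pred I) (F : I -> P) :
  iota (\sum_(k | Q k) F k) = \sum_(k | Q k) iota (F k).
Proof. by rewrite squares.unlock raddf_sum. Qed.
Lemma squares_prod (I : finType) (Q : pred I) (F : I -> P) :
  iota (\prod_(k | Q k) F k) = \prod_(k | Q k) iota (F k).
Proof. by rewrite squares.unlock rmorph_prod. Qed.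

Lemma ediv_uniq (p d q : P) : d != 0 -> p = d * q -> ediv p d = q.
Proof.
move=> d0 pE; have := @xgetPex _ 0 [set q | p = d * q]%classic.
by move=> /(_ (ex_intro _ q pE)); rewrite /= {1}pE => /(mulfI d0).
Qed.

Lemma swM i j p q : sw i j (p * q) = sw i j p * sw i j q.
Proof. exact: msymM. Qed.
Lemma swD i j p q : sw i j (p + q) = sw i j p + sw i j q.
Proof. exact: msymD. Qed.
Lemma swZ i j c p : sw i j (c *: p) = c *: sw i j p.
Proof. exact: msymZ. Qed.
Lemma sw_zvar i j k : sw i j (z k) = z (tperm i j k).
Proof. exact: msymXU. Qed.
Lemma tfM j p q : tf j (p * q) = tf j p * tf j q.
Proof. exact: rmorphM. Qed.
Lemma tfD j p q : tf j (p + q) = tf j p + tf j q.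
Proof. exact: comp_mpolyD. Qed.
Lemma tfZ j c p : tf j (c *: p) = c *: tf j p.
Proof. exact: comp_mpolyZ. Qed.
Lemma tfN j p : tf j (- p) = - tf j p.
Proof. exact: comp_mpolyN. Qed.
Lemma tf_zvar j k : tf j (z k) = if k == j then - z k else z k.
Proof. by rewrite /tf comp_mpolyXU -tnth_nth tnth_mktuple. Qed.

Lemma sw_squares i j p : sw i j (iota p) = iota (msym (tperm i j) p).
Proof.
elim/mpoly_indXM: p => [|p q Ep Eq|c p E|k p E].
- by rewrite msym1 squares1 /sw msym1.
- by rewrite msymD !squaresD swD Ep Eq.
- by rewrite msymZ !squaresZ swZ E.
by rewrite msymM !squaresM swM E s_X !squaresX expr2 swM sw_zvar.
Qed.

Lemma tf_squares j p : tf j (iota p) = iota p.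
Proof.
elim/mpoly_indXM: p => [|p q Ep Eq|c p E|k p E].
- by rewrite squares1 /tf comp_mpoly1.
- by rewrite squaresD tfD Ep Eq.
- by rewrite squaresZ tfZ E.
rewrite squaresM tfM E squaresX expr2 tfM tf_zvar.
by case: eqP => // _; rewrite mulrNN.
Qed.

Lemma mderiv_squares j p : (iota p)^`M(j) = 2%:R * z j * iota p^`M(j).
Proof.
elim/mpoly_indXM: p => [|p q Ep Eq|c p E|k p E].
- by rewrite squares1 -!mpolyC1 !mderivC squares0 mulr0.
- by rewrite squaresD !mderivD squaresD Ep Eq mulrDr.
- by rewrite squaresZ !mderivZ squaresZ E scalerAr.
rewrite mderivM squaresD !squaresM mderivM E !squaresX mderivXE !mderivXU /=.
have [->|_] := eqVneq j k; rewrite /= ?mulr1n.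
  by rewrite squares1 expr1 mulr1; ring.
by rewrite squares0; ring.
Qed.

Context (beta : nat) (gamma : R).
Local Notation C := (R[i]).
Local Notation b := (beta%:R : C).
Local Notation a := (real_complex R gamma + 2%:R^-1 : C).

Lemma zvar_neq0 j : z j != 0.
Proof.
rewrite /zvar; apply/eqP => /(congr1 (mcoeff U_(j))).
by rewrite mcoeffX eqxx mcoeff0 => /eqP; rewrite oner_eq0.
Qed.

Lemma addX_neq0 j k : k != j -> z j + z k != 0.
Proof.
move=> kj; have := subX_neq0 C kj; apply: contraNneq => /(congr1 (@tf R n j)).
rewrite /tf comp_mpolyD comp_mpoly0 -!/(tf j _) !tf_zvar eqxx (negPf kj) addrC.
by move=> ->.
Qed.

Lemma subz_neq0 j k : k != j -> z j - z k != 0.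
Proof. by move=> kj; apply: subX_neq0; rewrite eq_sym. Qed.

Lemma squares_divdiff j k p : iota p - iota (msym (tperm j k) p) =
  (z j ^+ 2 - z k ^+ 2) * iota (divdiff j k p).
Proof. by rewrite -squaresB divdiffP squaresM squaresB !squaresX. Qed.

(** Since [z_j^2 - z_k^2] factors, the two quotients of the type B operator are [z_j + z_k] and
    [z_j - z_k] times the same divided difference and add up to [2 z_j]; the [gamma] term kills even
    polynomials. *)
Lemma DB_squares j p : DB beta gamma j (iota p) = 2%:R * z j * iota (dunkl b j p).
Proof.
rewrite /DB tf_squares subrr (@ediv_uniq _ _ 0) ?zvar_neq0 ?mulr0 // scaler0 addr0.
rewrite mderiv_squares dunkl.unlock squaresD squaresZ squares_sum mulrDr; congr (_ + _).
rewrite -scalerAr mulr_sumr; congr (_ *: _); apply: eq_bigr => k kj.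
rewrite !sw_squares !tf_squares !squares_divdiff.
rewrite (@ediv_uniq _ _ ((z j + z k) * iota (divdiff j k p))) ?subz_neq0 //; last by ring.
rewrite (@ediv_uniq _ _ ((z j - z k) * iota (divdiff j k p))) ?addX_neq0 //; last by ring.
by ring.
Qed.

(** On an odd function of [z_j] the [gamma] term contributes [2 gamma], and differentiating [z_j]
    contributes 1; together they give [2 a]. *)
Lemma DB_zvar_squares j p :
  DB beta gamma j (z j * iota p) = 2%:R * iota (raise a beta j p).
Proof.
rewrite /DB tfM tf_squares tf_zvar eqxx.
rewrite (@ediv_uniq _ _ (2%:R * iota p)) ?zvar_neq0 //; last by ring.
rewrite mderivM mderivXU eqxx mul1r mderiv_squares /raise /sumswap euler.unlock dunkl.unlock.
rewrite !(squaresD, squaresM, squaresZ, squaresX, squares_sum).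
transitivity (iota p + z j * (2%:R * z j * iota p^`M(j)) + b *:
  (\sum_(k < n | k != j) 2%:R * (z j ^+ 2 * iota (divdiff j k p) + iota (msym (tperm j k) p)))
  + gamma%:C%C *: (2%:R * iota p)).
  congr (_ + _ *: _ + _); apply: eq_bigr => k kj.
  rewrite swM sw_zvar tpermL !tfM tf_zvar eqxx tfN tf_zvar (negPf kj).
  rewrite !sw_squares !tf_squares.
  have E : iota p = iota (msym (tperm j k) p)
      + (z j ^+ 2 - z k ^+ 2) * iota (divdiff j k p).
    by rewrite -squares_divdiff addrC subrK.
  rewrite (@ediv_uniq _ _ (z j * (z j + z k) * iota (divdiff j k p)
      + iota (msym (tperm j k) p))) ?subz_neq0 //; last by rewrite {1}E; ring.
  rewrite (@ediv_uniq _ _ (z j * (z j - z k) * iota (divdiff j k p)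
      + iota (msym (tperm j k) p))) ?addX_neq0 //; last by rewrite {1}E; ring.
  by ring.
rewrite -mulr_sumr big_split /= -mulr_sumr -!mul_mpolyC rmorphD /=.
have half : 2%:R * (2%:R^-1)%:MP = 1 :> P.
  rewrite -[X in X * _](rmorph_nat (@mpolyC n C)) -rmorphM divff ?pnatr_eq0 ?rmorph1 //.
apply/eqP; rewrite -subr_eq0; apply/eqP.
transitivity ((1 - 2%:R * (2%:R^-1)%:MP) * iota p); first by ring.
by rewrite half subrr mul0r.
Qed.

Lemma isqrt2_sqr : isqrt2 R * isqrt2 R = 2%:R^-1.
Proof.
rewrite /isqrt2 -rmorphM -expr2 exprVn sqr_sqrtr ?ler0n // fmorphV.
by rewrite (rmorph_nat (real_complex R)).
Qed.

(** [bop] maps an even polynomial to [z_j] times an even one and [bdag] maps it back. The sign flips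
    act trivially, so each swap counts twice. *)
Lemma hB_squares j p :
  hB beta gamma j (iota p) = 2%:R *: iota (ham b (a - 1) j p).
Proof.
have raiseZ c q : raise a beta j (c *: q) = c *: raise a beta j q.
  have sz : sumswap j (c *: q) = c *: sumswap j q.
    by rewrite /sumswap scaler_sumr; apply: eq_bigr => k _; rewrite msymZ.
  by rewrite /raise eulerZ sz -!mul_mpolyC; ring.
rewrite /hB.
have -> : bop beta gamma j (iota p) = z j * iota ((isqrt2 R * 2%:R) *: dunkl b j p).
  rewrite /bop DB_squares squaresZ -scalerA -scalerAr; congr (_ *: _).
  by rewrite scaler_nat; ring.
rewrite /bdag DB_zvar_squares raiseZ !squaresZ -lower_raise ham.unlock euler.unlock jm.unlock.
have -> : \sum_(k < n | (k < j)%N) (sw j k (iota p) + tf j (tf k (sw j k (iota p)))) =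
    2%:R * \sum_(k < n | (k < j)%N) iota (msym (tperm j k) p).
  rewrite mulr_sumr; apply: eq_bigr => k _; rewrite sw_squares !tf_squares; ring.
rewrite squaresB squaresD squaresM squaresX squaresZ squares_sum.
set A := iota (lower _ _ _ _); set D := iota (dunkl _ _ _); set S := \sum_(k < n | _) _.
pose r : P := (isqrt2 R)%:MP.
have rE : r * (r * 2%:R) = 1.
  rewrite /r -[2%:R](rmorph_nat (@mpolyC n C)) -!rmorphM mulrA isqrt2_sqr mulVf ?pnatr_eq0 ?rmorph1 //.
rewrite -!mul_mpolyC -/r !rmorphM -/r !rmorph_nat.
transitivity (r * (r * 2%:R) * (2%:R * (z j ^+ 2 * D - A)) + b%:MP * (2%:R * S)).
  by rewrite rmorph_nat; ring.
rewrite rE rmorph_nat; ring.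
Qed.

Local Notation act := (polyact (ham b (a - 1))).

Lemma Yfac_squares c e p : Yfac beta gamma c e (iota p) =
  iota (act (c%:MP - 'X_e.1 + 'X_e.2) p).
Proof.
have XM i q : act ('X_i * q) p = ham b (a - 1) i (act q p).
  exact: (polyactXM (@hamC n C b (a - 1))).
have X i : act 'X_i p = ham b (a - 1) i p by rewrite -[X in act X]mulr1 XM polyact1.
have hC : act c%:MP p = c *: p.
  by rewrite -[c%:MP]mulr1 mul_mpolyC (polyactZl (ham b (a - 1))) polyact1.
have half q : 2%:R^-1 *: (2%:R *: q) = q :> P.
  by rewrite scalerA mulVf ?scale1r // pnatr_eq0.
rewrite /Yfac !hB_squares !half (polyactDl (ham b (a - 1))) (polyactDl (ham b (a - 1))).
by rewrite (polyactNl (ham b (a - 1))) !X hC squaresD squaresB squaresZ.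
Qed.

Lemma foldr_Yfac_squares c (r : seq ('I_n * 'I_n)) p :
  foldr (fun e q => Yfac beta gamma c e q) (iota p) r =
  iota (act (\prod_(e <- r) (c%:MP - 'X_e.1 + 'X_e.2)) p).
Proof.
elim: r => [|e r /= ->]; first by rewrite big_nil polyact1.
by rewrite Yfac_squares big_cons (polyactMl (@hamC n C b (a - 1))).
Qed.

Lemma pairs_lt_prod (T : comNzRingType) (F : 'I_n * 'I_n -> T) :
  \prod_(e <- pairs_lt n) F e = \prod_(e : 'I_n * 'I_n | (e.1 < e.2)%N) F e.
Proof. by rewrite big_filter big_enum_cond; apply: eq_bigl => e; rewrite inE. Qed.

Lemma XL_squares : XL R n = iota (vdm n C).
Proof.
rewrite /XL pairs_lt_prod /vdm squares_prod; apply: eq_bigr => e _.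
by rewrite squaresB !squaresX.
Qed.

End EvenPolynomials.

(** * Moments of the weight *)

Import numFieldNormedType.Exports.
Local Open Scope classical_set_scope.

Section HalfLine.
Context {R : realType}.
Local Notation mu := (@lebesgue_measure R).

Lemma is_derive_continuous (F : R -> R) (x df : R) :
  is_derive x 1 F df -> {for x, continuous F}.
Proof.
by move=> dF; apply/differentiable_continuous/derivable1_diffP; exact: ex_derive.
Qed.

Lemma is_derive_inv (g : R -> R) (x dg : R) : g x != 0 -> is_derive x 1 g dg ->
  is_derive x 1 (fun y => (g y)^-1) (- (g x) ^- 2 *: dg).
Proof.
move=> g0 [dd <-]; apply: DeriveDef; first exact: derivableV.
exact: deriveV.
Qed.

Lemma continuous_powR_gt0 (s x : R) : 0 < x -> {for x, continuous (fun y : R => y `^ s)}.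
Proof. by move=> x0; exact: is_derive_continuous (is_derive1_powR s x0). Qed.

Lemma Rintegral_FTC2_pos (F f : R -> R) (a b : R) : 0 < a -> a < b ->
  (forall x : R, 0 < x -> is_derive x 1 F (f x)) ->
  (forall x : R, 0 < x -> {for x, continuous f}) ->
  \int[mu]_(x in `[a, b]) f x = F b - F a.
Proof.
move=> a0 ab dF cf; have b0 : 0 < b by exact: lt_trans ab.
rewrite /Rintegral (@continuous_FTC2 _ f F) //.
- apply: continuous_in_subspaceT => x; rewrite inE /= in_itv /= => /andP[ax _].
  by apply: cf; exact: lt_le_trans ax.
- split.
  + move=> x; rewrite in_itv /= => /andP[ax _].
    by have := dF x (lt_trans a0 ax) => ?; exact: ex_derive.
  + by apply: cvg_at_right_filter; exact/is_derive_continuous/dF.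
  + by apply: cvg_at_left_filter; exact/is_derive_continuous/dF.
- move=> x; rewrite in_itv /= => /andP[ax _]; rewrite derive1E.
  by have := dF x (lt_trans a0 ax) => ?; exact: derive_val.
Qed.

(** On the positive axis the squared one-variable weight times an even power has this form, and
    differentiation stays within the family. *)
Definition powgauss (s x : R) : R := x `^ s * expR (- x ^+ 2).

Lemma continuous_powgauss (s x : R) : 0 < x -> {for x, continuous (powgauss s)}.
Proof.
move=> x0; apply: continuousM; first exact: continuous_powR_gt0.
apply: continuous_comp; last exact: continuous_expR.
by apply: continuousN; apply: exprn_continuous.
Qed.

Lemma powgauss_ge0 s x : 0 <= powgauss s x.
Proof. by rewrite mulr_ge0 ?powR_ge0 ?expR_ge0. Qed.

Lemma is_derive_powgauss (t x : R) : 0 < x ->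
  is_derive x 1 (powgauss t) (t * powgauss (t - 1) x - 2 * powgauss (t + 1) x).
Proof.
move=> x0; have x0' : x != 0 by rewrite gt_eqF.
have dN : is_derive x 1 (fun y : R => - y ^+ 2) (- (x *+ 2)).
  by apply: is_derive_eq; rewrite /GRing.scale /=; ring.
have dE := @is_derive1_comp R expR (fun y : R => - y ^+ 2) x _ _
  (is_derive_expR (- x ^+ 2)) dN.
have dP := is_derive1_powR t x0.
apply: is_derive_eq (is_deriveM dP dE) _.
have E : x `^ (t + 1) = x `^ t * x.
  by rewrite powRD ?x0' ?implybT // powRr1 ?ltW.
rewrite /powgauss /GRing.scale /= E; ring.
Qed.

(** For [x <= 1] the square is at most 4; beyond that [x ^ t <= x ^ m], and the exponential series
    gives [x ^ (2 m) <= m! * expR (x ^ 2)]. *)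
Lemma powgauss_le (t : R) : 0 < t -> exists2 C : R, 0 <= C &
  forall x : R, 0 < x -> (1 + x `^ t) ^+ 2 * expR (- x ^+ 2) <= C.
Proof.
move=> t0; pose m := (Num.truncn t).+1.
have tm : t <= m%:R by rewrite ltW // truncnS_gt.
have m1 : 1 <= m`!%:R :> R by rewrite ler1n fact_gt0.
exists (4 * m`!%:R) => [|x x0]; first by lra.
have xt0 : 0 <= x `^ t by exact: powR_ge0.
rewrite expRN ler_pdivrMr ?expR_gt0 //.
have [x1|x1] := leP x 1.
  have xt1 : x `^ t <= 1.
    have := @ge0_ler_powR R t (ltW t0) x 1; rewrite powR1; apply => //.
      by rewrite nnegrE ltW.
    by rewrite nnegrE.
  have e1 : 1 <= expR (x ^+ 2) by rewrite (le_trans _ (expR_ge1Dx _)) // lerDl sqr_ge0.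
  have : (1 + x `^ t) ^+ 2 <= 4 by nra.
  by move=> /le_trans; apply; nra.
have xtm : x `^ t <= x ^+ m by rewrite -(powR_mulrn _ (ltW x0)) ler_powR // ltW.
have x1m : 1 <= x ^+ m by rewrite exprn_ege1 // ltW.
have e1 : (x ^+ m) ^+ 2 <= m`!%:R * expR (x ^+ 2).
  have := @expR_ge1Dxn R (x ^+ 2) (Num.truncn t) (sqr_ge0 x); rewrite -/m => h.
  rewrite -exprM mulnC exprM mulrC -ler_pdivrMr; last by lra.
  by apply: le_trans h; rewrite lerDr.
have : (1 + x `^ t) ^+ 2 <= 4 * (x ^+ m) ^+ 2 by nra.
by move=> /le_trans; apply; nra.
Qed.

Lemma compact_integrable_pos (f : R -> R) (a b : R) : 0 < a ->
  (forall x : R, 0 < x -> {for x, continuous f}) ->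
  mu.-integrable `[a, b] (EFin \o f).
Proof.
move=> a0 cf; apply: continuous_compact_integrable; first exact: segment_compact.
apply: continuous_in_subspaceT => x; rewrite inE /= in_itv /= => /andP[ax _].
by apply: cf; exact: lt_le_trans ax.
Qed.

Lemma powgauss_Rintegral_bounded (t : R) : 0 < t -> exists C : R,
  forall a b : R, 0 < a -> a < b -> \int[mu]_(x in `[a, b]) powgauss (t - 1) x <= C.
Proof.
move=> t0; have [C C0 HC] := powgauss_le t0; exists (C / t) => a b a0 ab.
(* [f] has the bounded primitive [F], and [powgauss_le] dominates the integrand by [(C / t) * f], so
   one comparison controls both ends of the half-line. *)
pose f (x : R) := t * x `^ (t - 1) / (1 + x `^ t) ^+ 2.
pose F (x : R) := - (1 + x `^ t)^-1.
have pos (x : R) : 0 < 1 + x `^ t by rewrite ltr_pwDl ?powR_ge0.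
have dP (x : R) : 0 < x -> is_derive x 1 (fun y : R => 1 + y `^ t) (t * x `^ (t - 1)).
  move=> x0; have d1 := is_derive_cst (1 : R) x (1 : R).
  by apply: is_derive_eq (is_deriveD d1 (is_derive1_powR t x0)) _; rewrite add0r.
have dF (x : R) : 0 < x -> is_derive x 1 F (f x).
  move=> x0.
  have dV : is_derive x 1 (fun y : R => (1 + y `^ t)^-1)
      (- (1 + x `^ t) ^- 2 *: (t * x `^ (t - 1))).
    by apply: is_derive_inv (dP x x0); rewrite gt_eqF.
  apply: is_derive_eq (is_deriveN dV) _.
  by rewrite /f /GRing.scale /= mulNr opprK mulrC.
have cf (x : R) : 0 < x -> {for x, continuous f}.
  move=> x0; apply: continuousM.
    by apply: continuousM; [exact: cvg_cst|exact: continuous_powR_gt0].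
  apply: continuousV; first by rewrite expf_neq0 // gt_eqF.
  apply: (@continuous_comp R R R (fun y => 1 + y `^ t) (fun y => y ^+ 2)); last exact: exprn_continuous.
  exact: is_derive_continuous (dP x x0).
have cb (x : R) : 0 < x -> {for x, continuous (powgauss (t - 1))} by exact: continuous_powgauss.
apply: (@le_trans _ _ (\int[mu]_(x in `[a, b]) ((C / t) * f x))).
  apply: le_Rintegral => //; first exact: compact_integrable_pos.
    apply: compact_integrable_pos => // x x0.
    by apply: continuousM; [exact: cvg_cst|exact: cf].
  move=> x; rewrite /= in_itv /= => /andP[ax _]; have x0 := lt_le_trans a0 ax.
  rewrite /powgauss /f mulrA mulrA divfK ?gt_eqF // ler_pdivlMr ?exprn_gt0 //.
  have := HC x x0; have := powR_ge0 x (t - 1); nra.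
rewrite RintegralZl //; last exact: compact_integrable_pos.
rewrite (Rintegral_FTC2_pos a0 ab dF cf); apply: ler_piMr; first by rewrite divr_ge0 // ltW.
rewrite /F.
have : (1 + a `^ t)^-1 <= 1 by rewrite invf_le1 // lerDl powR_ge0.
have : 0 <= (1 + b `^ t)^-1 by rewrite invr_ge0 ltW.
lra.
Qed.

Lemma powgauss_cvg_pinfty (t : R) : 0 < t -> powgauss t n.+2%:R @[n --> \oo] --> (0 : R).
Proof.
move=> t0; have [C C0 HC] : exists2 C : R, 0 <= C & forall x : R, 0 < x ->
    powgauss t x <= C / x.
  have [C C0 HC] := powgauss_le (addr_gt0 t0 ltr01); exists C => // x x0.
  rewrite ler_pdivlMr // (le_trans _ (HC x x0)) // /powgauss mulrAC ler_wpM2r ?expR_ge0 //.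
  have -> : x `^ t * x = x `^ (t + 1).
    by rewrite powRD ?(gt_eqF x0) ?implybT // powRr1 // ltW.
  have := powR_ge0 x (t + 1); nra.
apply: (@squeeze_cvgr _ _ _ _ (fun=> 0) (fun n : nat => C * (harmonic n : R))).
- near=> n; rewrite powgauss_ge0 (le_trans (HC _ _)) //= ler_wpM2l //.
  by rewrite lef_pV2 ?posrE // ler_nat.
- exact: cvg_cst.
- by rewrite -[0](mulr0 C); apply: cvgM; [exact: cvg_cst|exact: cvg_harmonic].
Unshelve. all: by end_near. Qed.

Lemma powgauss_cvg0 (t : R) : 0 < t -> powgauss t n.+1%:R^-1 @[n --> \oo] --> (0 : R).
Proof.
move=> t0; apply: (@squeeze_cvgr _ _ _ _ (fun=> 0) (fun n : nat => (harmonic n : R) `^ t)).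
- by near=> n; rewrite powgauss_ge0 /powgauss /= ler_piMr ?powR_ge0 // expR_le1 oppr_le0 sqr_ge0.
- exact: cvg_cst.
- have /cvg_at_rightP := powR_cvg0 t0; apply; split; first exact: harmonic_gt0.
  exact: cvg_harmonic.
Unshelve. all: by end_near. Qed.

(** Compact intervals exhausting the open half-line; they avoid 0, where the weight is singular for
    negative [gamma]. *)
Local Notation I n := `[n.+1%:R^-1, n.+2%:R].

Lemma inv_lt_natS n : n.+1%:R^-1 < n.+2%:R :> R.
Proof.
rewrite (@le_lt_trans _ _ 1) ?invf_le1 ?ler1n ?ltr0n // ltr1n //.
Qed.

(** The expression is the integral of the derivative of [powgauss t], hence a difference of boundary
    values, both tending to 0. *)
Lemma powgauss_recursion (t : R) : 0 < t ->
  t * (\int[mu]_(x in I n) powgauss (t - 1) x) - 2 * (\int[mu]_(x in I n) powgauss (t + 1) x)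
    @[n --> \oo] --> (0 : R).
Proof.
move=> t0; have -> : (fun n : nat => t * (\int[mu]_(x in I n) powgauss (t - 1) x)
    - 2 * (\int[mu]_(x in I n) powgauss (t + 1) x)) =
    (fun n : nat => powgauss t n.+2%:R - powgauss t n.+1%:R^-1).
  apply/funext => n; have a0 : 0 < n.+1%:R^-1 :> R by rewrite invr_gt0 ltr0n.
  have ci (s x : R) : 0 < x -> {for x, continuous (powgauss s)} by exact: continuous_powgauss.
  have iZ (c s : R) : mu.-integrable (I n) (EFin \o (fun x => c * powgauss s x)).
    apply: compact_integrable_pos => // x x0.
    by apply: continuousM; [exact: cvg_cst|exact: ci].
  have iB s : mu.-integrable (I n) (EFin \o powgauss s).
    by apply: compact_integrable_pos => //; exact: ci.
  rewrite -!RintegralZl //; [|exact: iB..].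
  rewrite -RintegralB //.
  rewrite (Rintegral_FTC2_pos a0 (inv_lt_natS n) (@is_derive_powgauss t)) // => x x0.
  by apply: continuousB; (apply: continuousM; [exact: cvg_cst|exact: ci]).
by have := cvgB (powgauss_cvg_pinfty t0) (powgauss_cvg0 t0); rewrite subrr; apply.
Qed.

(** The symmetric sets [J n] increase to the complement of the null set formed by 0, so monotone
    convergence applies, and evenness makes each integral twice the one over [I n]. *)
Lemma even_integral_cvg (h : R -> R) : (forall x, 0 <= h x) ->
  measurable_fun setT h -> (forall x, h (- x) = h x) ->
  (forall x : R, 0 < x -> {for x, continuous h}) ->
  (2 * \int[mu]_(x in I n) h x)%:E @[n --> \oo] --> (\int[mu]_x (h x)%:E)%E.
Proof.
move=> h0 mh heven ch.
pose J n := `[- n.+2%:R, - n.+1%:R^-1] `|` `[n.+1%:R^-1, n.+2%:R] : set R.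
have mJ n : measurable (J n) by exact: measurableU.
have JE : \bigcup_n J n = [set~ (0 : R)].
  apply/seteqP; split => [x [n _ [|]]|x /eqP x0] /=.
  - rewrite in_itv /= => /andP[_ x0]; apply/eqP; rewrite lt_eqF //.
    by rewrite (le_lt_trans x0) // oppr_lt0 invr_gt0 ltr0n.
  - rewrite in_itv /= => /andP[x0 _]; apply/eqP; rewrite gt_eqF //.
    by rewrite (lt_le_trans _ x0) // invr_gt0 ltr0n.
  have x0' : 0 < `|x| by rewrite normr_gt0.
  pose n := (Num.truncn `|x| + Num.truncn `|x|^-1)%N.
  have h1 : `|x| <= n.+2%:R.
    by rewrite (le_trans (ltW (truncnS_gt _))) // ler_nat /n ltnS leqW // leq_addr.
  have h2 : n.+1%:R^-1 <= `|x|.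
    have i0 : 0 < `|x|^-1 by rewrite invr_gt0.
    have ix : `|x|^-1 <= n.+1%:R.
      by rewrite (le_trans (ltW (truncnS_gt _))) // ler_nat /n ltnS leq_addl.
    by rewrite -(invrK `|x|) lef_pV2 // posrE // ltr0n.
  exists n => //; have [xp|xn] := leP 0 x.
    by right; move: h1 h2; rewrite /= in_itv /= ger0_norm // => -> ->.
  by left; move: h1 h2; rewrite /= in_itv /= ltr0_norm // lerNl lerNr => -> ->.
have ndJ : nondecreasing_seq J.
  apply/nondecreasing_seqP => n; rewrite subsetEset.
  have ab1 : n.+2%:R <= n.+3%:R :> R by rewrite ler_nat.
  have ab2 : n.+2%:R^-1 <= n.+1%:R^-1 :> R by rewrite lef_pV2 ?posrE ?ltr0n // ler_nat.
  apply: setUSS => x /=; rewrite !in_itv /= => /andP[xa xb].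
    by rewrite (le_trans _ xa) ?lerN2 // (le_trans xb) // lerN2.
  by rewrite (le_trans ab2 xa) (le_trans xb ab1).
have -> : (\int[mu]_x (h x)%:E = \int[mu]_(x in \bigcup_n J n) (h x)%:E)%E.
  rewrite JE -(integral_setD1 (r := 0) (D := setT)) //.
  - by congr integral; rewrite setTD.
  - exact: measurableD.
  - by apply/measurable_EFinP/measurable_funTS.
have -> : (fun n : nat => (2 * \int[mu]_(x in I n) h x)%:E) =
    (fun n : nat => (\int[mu]_(x in J n) (h x)%:E)%E).
  apply/funext => n; have a0 : 0 < n.+1%:R^-1 :> R by rewrite invr_gt0 ltr0n.
  have ab := inv_lt_natS n.
  rewrite ge0_integral_setU //=; last 3 first.
  - by apply/measurable_EFinP/measurable_funTS.
  - by move=> x _; rewrite lee_fin.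
  - apply/disj_setPRL => x /=; rewrite !in_itv /= => /andP[xa _] /andP[_ xb].
    by have := lt_le_trans a0 (le_trans xa xb); rewrite oppr_gt0 ltNge (ltW a0).
  rewrite integration_by_substitution_oppr; last 2 first.
  - exact: ltW.
  - apply: continuous_in_subspaceT => x; rewrite inE /= in_itv /= => /andP[_ xb].
    have xN : 0 < - x by rewrite (lt_le_trans a0) // lerNr.
    have -> : h = h \o -%R by apply/funext => y; rewrite /= heven.
    by apply: continuous_comp; [exact: opp_continuous|exact: ch].
  have -> : (h \o -%R) = h by apply/funext => y; rewrite /= heven.
  rewrite /Rintegral mulr_natl mulr2n EFinD fineK //.
  exact/integrable_fin_num/compact_integrable_pos.
apply: ge0_nondecreasing_set_cvg_integral => //.
- by move=> n; apply/measurable_EFinP/measurable_funTS.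
- by move=> n x _; rewrite lee_fin.
Qed.
End HalfLine.

(** * Even moments of the one-variable weight *)

Section GaussianMoments.
Context {R : realType} (gamma : R).
Local Notation mu := (@lebesgue_measure R).

Definition weight (x : R) : R := (`|x| `^ gamma * expR (- (x ^+ 2) / 2%:R)) ^+ 2.

Definition even_monomial (k : nat) (x : R) : R := x ^+ (2 * k) * weight x.

Lemma even_monomial_ge0 k x : 0 <= even_monomial k x.
Proof. by rewrite mulr_ge0 ?sqr_ge0 // exprM exprn_ge0 ?sqr_ge0. Qed.

Lemma even_monomialN k x : even_monomial k (- x) = even_monomial k x.
Proof. by rewrite /even_monomial /weight normrN sqrrN exprM sqrrN -exprM. Qed.

Lemma measurable_even_monomial k : measurable_fun setT (even_monomial k).
Proof.
apply: measurable_funM; first exact: measurable_funX.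
apply: measurable_funX; apply: measurable_funM.
  apply: (measurableT_comp (measurable_powR gamma)).
  exact: normr_measurable.
apply: measurableT_comp => //; apply: measurable_funM => //.
by apply: measurableT_comp => //; exact: measurable_funX.
Qed.

Lemma continuous_even_monomial k (x : R) : 0 < x -> {for x, continuous (even_monomial k)}.
Proof.
move=> x0; apply: continuousM; first exact: exprn_continuous.
apply: (@continuous_comp R R R (fun y => `|y| `^ gamma * expR (- (y ^+ 2) / 2%:R))
  (fun y => y ^+ 2)); last exact: exprn_continuous.
apply: continuousM.
  apply: (@continuous_comp R R R (fun y => `|y|) (fun y => y `^ gamma)).
    exact: norm_continuous.
  by apply: continuous_powR_gt0; rewrite normr_gt0 gt_eqF.
apply: (@continuous_comp R R R (fun y => - (y ^+ 2) / 2%:R) expR); last exact: continuous_expR.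
apply: continuousM; last exact: cvg_cst.
by apply: continuousN; exact: exprn_continuous.
Qed.

Lemma even_monomialE k (x : R) : 0 < x ->
  even_monomial k x = powgauss ((2 * k)%:R + 2 * gamma) x.
Proof.
move=> x0; rewrite /even_monomial /weight /powgauss exprMn gtr0_norm //.
rewrite powRD ?(gt_eqF x0) ?implybT // (powR_mulrn _ (ltW x0)) -mulrA; congr (_ * (_ * _)).
  by rewrite mulrC powRrM -powR_mulrn ?powR_ge0.
by rewrite expr2 -expRD; congr expR; field.
Qed.

Context (gamma_gt : - 2%:R^-1 < gamma).
Local Notation I n := `[n.+1%:R^-1, n.+2%:R].

Lemma even_monomial_Rintegral k n :
  \int[mu]_(x in I n) even_monomial k x =
  \int[mu]_(x in I n) powgauss ((2 * k)%:R + 2 * gamma) x.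
Proof.
apply: eq_Rintegral => x; rewrite inE /= in_itv /= => /andP[ax _].
by apply: even_monomialE; rewrite (lt_le_trans _ ax) // invr_gt0 ltr0n.
Qed.

Let exponent_gt0 k : 0 < (2 * k)%:R + 2 * gamma + 1.
Proof. by have : 0 <= (2 * k)%:R :> R by []; move: gamma_gt; lra. Qed.

Lemma even_monomial_cvg k :
  (2 * \int[mu]_(x in I n) even_monomial k x)%:E @[n --> \oo] -->
  (\int[mu]_x (even_monomial k x)%:E)%E.
Proof.
apply: even_integral_cvg; [exact: even_monomial_ge0|exact: measurable_even_monomial|
  exact: even_monomialN|exact: continuous_even_monomial].
Qed.

(** The integrals over the [I n] are uniformly bounded because [gamma_gt] makes [2k + 2 gamma + 1]
    positive. *)
Lemma integrable_even_monomial k : mu.-integrable setT (EFin \o even_monomial k).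
Proof.
apply/integrableP; split; first by apply/measurable_EFinP; exact: measurable_even_monomial.
under eq_integral do rewrite /= ger0_norm ?even_monomial_ge0 //.
have [C HC] := powgauss_Rintegral_bounded (exponent_gt0 k).
have cv := @even_monomial_cvg k.
apply: (@le_lt_trans _ _ (2 * C)%:E); last exact: ltry.
rewrite -(cvg_lim (@ereal_hausdorff R) cv); apply: lime_le; first by apply/cvg_ex; eexists; exact: cv.
near=> n; rewrite lee_fin ler_wpM2l // even_monomial_Rintegral.
have := HC n.+1%:R^-1 n.+2%:R; rewrite addrK; apply; last exact: inv_lt_natS.
by rewrite invr_gt0 ltr0n.
Unshelve. all: by end_near. Qed.

Definition even_moment k : R := \int[mu]_x even_monomial k x.

(** Limit of [powgauss_recursion] at [t = 2k + 2 gamma + 1]; the factor [t / 2] is the coefficient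
    of the recursion. *)
Lemma even_momentS k :
  even_moment k.+1 = (k%:R + (gamma + 2%:R^-1)) * even_moment k.
Proof.
have cv j : 2 * \int[mu]_(x in I n) even_monomial j x @[n --> \oo] --> even_moment j.
  have := @even_monomial_cvg j.
  rewrite -[X in _ --> X](@fineK R); last exact/integrable_fin_num/integrable_even_monomial.
  by move/fine_cvg.
have t0 := exponent_gt0 k; set t := (2 * k)%:R + 2 * gamma + 1 in t0.
have c1 : t * (\int[mu]_(x in I n) powgauss (t - 1) x)
    - 2 * (\int[mu]_(x in I n) powgauss (t + 1) x) @[n --> \oo]
    --> t / 2 * even_moment k - even_moment k.+1.
  have -> : (fun n : nat => t * (\int[mu]_(x in I n) powgauss (t - 1) x)
      - 2 * (\int[mu]_(x in I n) powgauss (t + 1) x)) =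
    (fun n : nat => t / 2 * (2 * \int[mu]_(x in I n) even_monomial k x)
      - 2 * \int[mu]_(x in I n) even_monomial k.+1 x).
    apply/funext => n; rewrite !even_monomial_Rintegral.
    have -> : (2 * k.+1)%:R + 2 * gamma = t + 1 by rewrite /t !natrM -[k.+1]addn1 natrD; ring.
    by rewrite {3}/t addrK; field.
  by apply: cvgB; [apply: cvgM; [exact: cvg_cst|exact: cv]|exact: cv].
have /subr0_eq <- : t / 2 * even_moment k - even_moment k.+1 = 0.
  by apply: (cvg_unique (@Rhausdorff R) c1); exact: powgauss_recursion.
congr (_ * _).
by rewrite /t natrM; field.
Qed.

End GaussianMoments.

(** * Iterated integrals of sums of products *)

Section IteratedIntegrals.
Context {R : realType}.
Local Notation mu := (@lebesgue_measure R).

Lemma Rintegral_sum_scaled (I : Type) (r : seq I) (d : I -> R) (g : I -> R -> R) :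
  (forall i, mu.-integrable setT (EFin \o g i)) ->
  mu.-integrable setT (EFin \o (fun x => \sum_(i <- r) d i * g i x)) /\
  \int[mu]_x (\sum_(i <- r) d i * g i x) = \sum_(i <- r) d i * \int[mu]_x g i x.
Proof.
move=> ig; have iZ i : mu.-integrable setT (EFin \o (fun x => d i * g i x)).
  exact: (integrableZl measurableT (d i) (ig i)).
elim: r => [|i r [ih1 ih2]].
  have E : (fun x : R => \sum_(i <- [::]) d i * g i x) = cst 0.
    by apply/funext => x; rewrite big_nil.
  by rewrite E big_nil /Rintegral integral0; split => //; exact: integrable0.
have E : (fun x => \sum_(k <- i :: r) d k * g k x) =
    (fun x => d i * g i x + \sum_(k <- r) d k * g k x).
  by apply/funext => x; rewrite big_cons.
rewrite E; split; last by rewrite RintegralD // RintegralZl // ih2 big_cons.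
exact: (integrableD measurableT (iZ i) ih1).
Qed.

(** By induction the inner integral is a finite combination of the functions [h i 0], so each
    integration is one-dimensional. Indexing [h] by [nat] lets the induction shift coordinates. *)
Lemma intRn_sum_prod (n : nat) (I : Type) (r : seq I) (c : I -> R)
    (h : I -> nat -> R -> R) :
  (forall i j, mu.-integrable setT (EFin \o h i j)) ->
  intRn n (fun z => \sum_(i <- r) c i * \prod_(j < n) h i j (z j)) =
  \sum_(i <- r) c i * \prod_(j < n) \int[mu]_x h i j x.
Proof.
elim: n c h => [|n IH] c h ih /=; first by under eq_bigr do rewrite !big_ord0; under [RHS]eq_bigr do rewrite big_ord0.
have E x : intRn n (fun z => \sum_(i <- r) c i * \prod_(j < n.+1) h i j (Defs.ncons x z j)) =
    \sum_(i <- r) (c i * \prod_(j < n) \int[mu]_y h i j.+1 y) * h i 0%N x.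
  transitivity (intRn n (fun z => \sum_(i <- r) (c i * h i 0%N x) *
      \prod_(j < n) h i j.+1 (z j))).
    congr intRn; apply/funext => z; apply: eq_bigr => i _.
    by rewrite big_ord_recl -mulrA.
  rewrite (IH (fun i => c i * h i 0%N x) (fun i j => h i j.+1)) //.
  by apply: eq_bigr => i _; rewrite mulrAC.
under eq_Rintegral do rewrite E.
have [_ ->] := @Rintegral_sum_scaled _ r (fun i => c i * \prod_(j < n) \int[mu]_y h i j.+1 y)
  (fun i => h i 0%N) (fun i => ih i 0%N).
by apply: eq_bigr => i _; rewrite big_ord_recl mulrAC mulrA.
Qed.
End IteratedIntegrals.

(** * The scalar product on even polynomials *)

Section ScalarProduct.
Context (R : realType) (n : nat) (gamma : R).
Local Notation C := (R[i]).
Local Notation P := {mpoly C[n]}.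
Local Notation iota := (@squares R n).
Local Notation cplx := (real_complex R).
Implicit Types (p q : P) (z : nat -> R).

Definition cmoment (k : nat) : C := cplx (even_moment gamma k).

Lemma evalRM p q z : evalR (p * q) z = evalR p z * evalR q z.
Proof. exact: mevalM. Qed.

Lemma evalR_squares p z : evalR (iota p) z =
  \sum_(m <- msupp p) p@_m * cplx (\prod_(j < n) z j ^+ (2 * m j)).
Proof.
rewrite /evalR squares.unlock comp_mpoly_meval mevalE; apply: eq_bigr => m _.
rewrite rmorph_prod; congr (_ * _); apply: eq_bigr => j _ /=.
by rewrite tnth_mktuple rmorphXn /= /zvar mevalXU rmorphXn exprM.
Qed.

(** Squaring makes the exponent even, which removes the absolute values and turns the interaction
    factor into a polynomial. *)
Lemma phiB_sqr (b : nat) z : cplx (phiB n gamma b z ^+ 2) =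
  evalR (iota (vdm n C ^+ (2 * b))) z * cplx (\prod_(j < n) weight gamma (z j)).
Proof.
have -> : iota (vdm n C ^+ (2 * b)) = XL R n ^+ (2 * b).
  by rewrite XL_squares squares.unlock rmorphXn.
have -> : evalR (XL R n ^+ (2 * b)) z =
    cplx ((\prod_(e <- pairs_lt n) (z e.1 ^+ 2 - z e.2 ^+ 2)) ^+ (2 * b)).
  rewrite /evalR !rmorphXn /= /XL !rmorph_prod; congr (_ ^+ _); apply: eq_bigr => e _.
  by rewrite /zvar !rmorphB /= !rmorphXn /= !mevalXU.
rewrite -rmorphM /phiB exprMn; congr (cplx (_ * _)).
  rewrite prodrXl -exprM -normr_prod [(b * 2)%N]mulnC exprM real_normK ?num_real //.
  by rewrite -exprM.
by rewrite -prodrXl.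
Qed.

Lemma intCN_squares (gamma_gt : - 2%:R^-1 < gamma) p :
  intCN n (fun z => evalR (iota p) z * cplx (\prod_(j < n) weight gamma (z j))) =
  moment cmoment p.
Proof.
have E z : evalR (iota p) z * cplx (\prod_(j < n) weight gamma (z j)) =
    \sum_(m <- msupp p) p@_m * cplx (\prod_(j < n) even_monomial gamma (m j) (z j)).
  rewrite evalR_squares mulr_suml; apply: eq_bigr => m _.
  by rewrite -mulrA -rmorphM -big_split.
have ReE (r : seq 'X_{1..n}) (y : 'X_{1..n} -> R) :
    complex.Re (\sum_(m <- r) p@_m * cplx (y m)) = \sum_(m <- r) complex.Re p@_m * y m.
  elim: r => [|m r IH]; first by rewrite !big_nil.
  by rewrite !big_cons -IH; case: (p@_m) => u v; case: (\sum_(i <- r) _) => u' v'; rewrite /= mulr0 subr0.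
have ImE (r : seq 'X_{1..n}) (y : 'X_{1..n} -> R) :
    complex.Im (\sum_(m <- r) p@_m * cplx (y m)) = \sum_(m <- r) complex.Im p@_m * y m.
  elim: r => [|m r IH]; first by rewrite !big_nil.
  by rewrite !big_cons -IH; case: (p@_m) => u v; case: (\sum_(i <- r) _) => u' v'; rewrite /= mulr0 add0r.
(* [nth] extends a multi-index by 0 beyond [n], giving the [nat]-indexed family that
   [intRn_sum_prod] expects. *)
have int_em m j := @integrable_even_monomial R gamma gamma_gt (nth 0%N m j).
pose h (m : 'X_{1..n}) (j : nat) := even_monomial gamma (nth 0%N m j).
have hE (m : 'X_{1..n}) (j : 'I_n) : even_monomial gamma (m j) = h m j.
  by rewrite /h /fun_of_multinom (tnth_nth 0%N).
have int_c (c : 'X_{1..n} -> R) :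
    intRn n (fun z => \sum_(m <- msupp p) c m * \prod_(j < n) even_monomial gamma (m j) (z j)) =
    \sum_(m <- msupp p) c m * \prod_(j < n) even_moment gamma (m j).
  transitivity (intRn n (fun z => \sum_(m <- msupp p) c m * \prod_(j < n) h m j (z j))).
    congr intRn; apply/funext => z; apply: eq_bigr => m _; congr (_ * _).
    by apply: eq_bigr => j _; rewrite hE.
  rewrite intRn_sum_prod => [|m j]; last exact: int_em.
  by apply: eq_bigr => m _; congr (_ * _); apply: eq_bigr => j _; rewrite /even_moment hE.
have -> : moment cmoment p =
    \sum_(m <- msupp p) p@_m * cplx (\prod_(j < n) even_moment gamma (m j)).
  by rewrite moment.unlock /mext; apply: eq_bigr => m _; rewrite rmorph_prod.
apply/eqP; rewrite eq_complex /intCN; apply/andP; split; apply/eqP.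
  rewrite ReE -int_c; congr intRn; apply/funext => z.
  by rewrite -ReE -E.
rewrite ImE -int_c; congr intRn; apply/funext => z.
by rewrite -ImE -E.
Qed.

Lemma scalL_squares (gamma_gt : - 2%:R^-1 < gamma) (beta : nat) p q :
  scalL n gamma beta (evalR (iota p)) (evalR (iota q)) = pairing cmoment beta p q.
Proof.
rewrite /pairing -intCN_squares // /scalL; congr intCN; apply/funext => z.
by rewrite phiB_sqr mulrA !squaresM !evalRM.
Qed.

Lemma cmomentS (gamma_gt : - 2%:R^-1 < gamma) k :
  cmoment k.+1 = (k%:R + (cplx gamma + 2%:R^-1)) * cmoment k.
Proof.
rewrite /cmoment even_momentS // rmorphM !rmorphD fmorphV.
by rewrite !(rmorph_nat cplx).
Qed.
End ScalarProduct.

(** * Reduction of the adjoint relation to the pairing *)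

Unset Implicit Arguments.

Theorem theorem4p9 (R : realType) (N : nat) (beta : nat) (gamma : R)
  (hN : (1 <= N)%N) (hgamma : - 2%:R^-1 < gamma)
  (f g : {mpoly R[i][N]}) :
  sym_in_squares f -> sym_in_squares g ->
  scalL N gamma beta.+1 (GL beta gamma f) (evalR g)
  = scalL N gamma beta (evalR f) (evalR (GLhat beta gamma g)).
Proof.
move=> [F [Fsym fE]] [G [Gsym gE]]; set C := (R[i] : idomainType).
have {fE}-> : f = squares F by rewrite squares.unlock.
have {gE}-> : g = squares G by rewrite squares.unlock.
have {}Fsym t : msym t F = F by exact: (issymP _ Fsym).
have {}Gsym t : msym t (vdm N C * G) = (-1) ^+ t * (vdm N C * G).
  by rewrite msymM msym_vdm (issymP _ Gsym) mulrA.
set a := real_complex R gamma + 2%:R^-1 : C; set b := beta%:R : C.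
have XG : XL R N * squares G = squares (vdm N C * G) by rewrite XL_squares squaresM.
(* The integrands agree pointwise: raising [beta] by one multiplies the squared weight by [XL ^ 2],
   and one factor [XL] is absorbed by the denominator of [GL]. *)
transitivity (scalL N gamma beta (evalR (YL beta gamma (squares F)))
    (evalR (XL R N * squares G))).
  rewrite /scalL; congr intCN; apply/funext => z; rewrite /GL evalRM.
  have -> : phiB N gamma beta.+1 z =
      (\prod_(e <- pairs_lt N) `|z e.1 ^+ 2 - z e.2 ^+ 2|) * phiB N gamma beta z.
    rewrite /phiB mulrA; congr (_ * _); rewrite -big_split /=.
    by apply: eq_bigr => e _; rewrite exprS.
  have XE : evalR (XL R N) z = real_complex R (\prod_(e <- pairs_lt N) (z e.1 ^+ 2 - z e.2 ^+ 2)).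
    rewrite /evalR /XL !rmorph_prod; apply: eq_bigr => e _.
    by rewrite /zvar !rmorphB /= !rmorphXn /= !mevalXU.
  rewrite -normr_prod exprMn real_normK ?num_real // rmorphM rmorphXn /= -XE.
  (* On the zero set of [XL] the quotient in [GL] takes the default value 0, and the other side
     vanishes through its factor [XL]. *)
  have [->|X0] := eqVneq (evalR (XL R N) z) 0; first by rewrite expr0n /= !(mul0r, mulr0).
  by field.
rewrite XG /GLhat XG /YL /YLhat !foldr_Yfac_squares !pairs_lt_prod !scalL_squares //.
pose pair := @pairing N C (cmoment gamma) beta.
have pC p q : pair p q = pair q p by exact: pairingC.
have pD p : {morph pair p : q r / q + r} by exact: pairingDr.
have pZ p c q : pair p (c *: q) = c * pair p q by exact: pairingZr.
have pS t p q : pair (msym t p) (msym t q) = pair p q by exact: pairing_msym.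
have pH i p q : pair (ham b (a - 1) i p) q = pair p (ham b (a - 1) i q).
  by apply: pairing_ham => k; exact: cmomentS.
have two0 : 2%:R != 0 :> C by rewrite pnatr_eq0.
(* Self-adjointness moves the operator from [F] to the antisymmetric [vdm N C * G], where [PF]
   exchanges [beta] for [- beta]. *)
have PA p := @pair_polyact N C b (a - 1) pair pC pD pZ pH p F (vdm N C * G).
have PF := @pair_polyact_factors N C b (a - 1) pair pD pZ pS two0 F (vdm N C * G) b Fsym Gsym.
rewrite -/pair PA PF; congr (pair _ (polyact _ _ _)).
by apply: eq_bigr => e _; rewrite mpolyCN.
Qed.
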